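(* Let $F$ be the random subset of the self-similar set $\Lambda$ described in the context, generated by an IFS $\{f_1,\dots,f_N\}$ with contraction ratios $r_1,\dots,r_N$, an integer $M\ge 2$, and a probability vector $\mathbf{p}=(p_1,\dots,p_N)\in(0,1)^N$. For $\mathbf{x}=(x_1,\dots,x_N)\in[0,\infty)^N$ put $$\psi(\mathbf{x}):=\sum_{i=1}^N x_i\Big(\log\sum_{j=1}^N x_j-\log x_i\Big),\qquad \phi(\mathbf{x}):=\sum_{i=1}^N x_i\log(Mp_i),\qquad h(\mathbf{x}):=-\sum_{i=1}^N x_i\log r_i.$$ Then, $\mathbb{P}$-almost surely, $$\dim_H F=\dim_B F=\max\big\{\psi(\mathbf{x})+\min\{0,\phi(\mathbf{x})\}:\ \mathbf{x}\in[0,\infty)^N,\ h(\mathbf{x})=1\big\}.$$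
   Context: Logarithms are natural, with the convention $0\log 0=0$. $\dim_H$ and $\dim_B$ denote Hausdorff and box-counting dimension. Setup: $N\ge2$, $d\ge 1$, and $f_1,\dots,f_N:\mathbb{R}^d\to\mathbb{R}^d$ are similarities with contraction ratios $r_i\in(0,1)$, i.e. $|f_i(x)-f_i(y)|=r_i|x-y|$. It is assumed that there is a non-empty bounded open set $U\subset\mathbb{R}^d$ such that (O1) $f_i(U)\subset U$ for all $i$; (O2) $f_i(U)\cap f_j(U)=\emptyset$ for all $i\ne j$; (O3) $U$ is the interior of its closure. $\Lambda$ is the attractor, i.e. the unique non-empty compact set with $\Lambda=\bigcup_{i=1}^N f_i(\Lambda)$. Random subset: $M\geq 2$ is an integer and $\mathbf{p}=(p_1,\dots,p_N)\in(0,1)^N$ satisfies $\sum_i p_i=1$. Consider the full infinite $M$-ary tree (rooted tree in which every vertex has exactly $M$ children) with edge set $E$. Under $\mathbb{P}$, the edge labels $\omega(e)$, $e\in E$, are independent with values in $\{1,\dots,N\}$ and $\mathbb{P}(\omega(e)=i)=p_i$. $\mathcal{P}$ is the set of infinite paths starting at the root (moving away from the root), $P(k)$ is the $k$-th edge of $P\in\mathcal{P}$, and $$F=F(\omega):=\Big\{\lim_{n\to\infty} f_{\omega(P(1))}\circ\dots\circ f_{\omega(P(n))}(0): P\in\mathcal{P}\Big\}\subset\Lambda.$$ *)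

(* Defs.v *)
From HB Require Import structures.
From mathcomp Require Import all_boot all_order all_algebra.
From mathcomp Require Import all_classical all_reals all_analysis.

Set Implicit Arguments.
Unset Strict Implicit.
Unset Printing Implicit Defensive.

Import Order.TTheory GRing.Theory Num.Theory.
Import numFieldNormedType.Exports.

Local Open Scope classical_set_scope.
Local Open Scope ring_scope.

(* The library's norm on 'rV[R]_d is the sup norm. It is used only through
   topological notions and boundedness, which do not depend on the choice of
   norm; similarities and diameters are taken with respect to [enorm]. *)
Definition enorm (R : realType) (d : nat) (x : 'rV[R]_d) : R :=
  Num.sqrt (\sum_(i < d) x ord0 i ^+ 2).

Definition similarity (R : realType) (d : nat) (r : R)
    (g : 'rV[R]_d -> 'rV[R]_d) : Prop :=
  forall x y, enorm (g x - g y) = r * enorm (x - y).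

Definition open_set_condition (R : realType) (N d : nat)
    (f : 'I_N -> 'rV[R]_d -> 'rV[R]_d) (U : set 'rV[R]_d) : Prop :=
  [/\ (forall i, f i @` U `<=` U),
      (forall i j, i != j -> f i @` U `&` f j @` U = set0) &
      U = interior (closure U)].

(* The diameter of the empty set is -oo. *)
Definition ediam (R : realType) (d : nat) (A : set 'rV[R]_d) : \bar R :=
  ereal_sup [set z | exists x y, [/\ A x, A y & z = (enorm (x - y))%:E]].

(* diam(A)^s, where 0^0 = 1 for nonempty A, and the empty set has weight 0. *)
Definition diam_weight (R : realType) (d : nat) (s : R) (A : set 'rV[R]_d) :
    \bar R :=
  if `[< A = set0 >] then 0%E else poweR (ediam A) s.

Definition hausdorff_premeasure (R : realType) (d : nat) (s delta : R)
    (A : set 'rV[R]_d) : \bar R :=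
  ereal_inf [set z | exists C : nat -> set 'rV[R]_d,
    [/\ A `<=` \bigcup_n C n,
        (forall n, (ediam (C n) <= delta%:E)%E) &
        z = (\sum_(0 <= n <oo) diam_weight s (C n))%E]].

Definition hausdorff_measure (R : realType) (d : nat) (s : R)
    (A : set 'rV[R]_d) : \bar R :=
  ereal_sup [set hausdorff_premeasure s delta A | delta in [set u : R | 0 < u]].

Definition hausdorff_dim (R : realType) (d : nat) (A : set 'rV[R]_d) : \bar R :=
  ereal_inf [set s%:E | s in
    [set s : R | 0 <= s /\ hausdorff_measure s A = 0%E]].

(* Smallest number of sets of diameter at most delta covering A; +oo if no
   finite number suffices. *)
Definition covering_number (R : realType) (d : nat) (delta : R)
    (A : set 'rV[R]_d) : \bar R :=
  ereal_inf [set z | exists (n : nat) (C : 'I_n -> set 'rV[R]_d),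
    [/\ A `<=` \bigcup_i C i,
        (forall i, (ediam (C i) <= delta%:E)%E) &
        z = (n%:R : R)%:E]].

Definition box_ratio (R : realType) (d : nat) (A : set 'rV[R]_d) (delta : R) :
    \bar R :=
  (lne (covering_number delta A) * ((- ln delta)^-1)%:E)%E.

Definition lower_box_dim (R : realType) (d : nat) (A : set 'rV[R]_d) : \bar R :=
  limf_einf (box_ratio A) (0 : R)^'+.

Definition upper_box_dim (R : realType) (d : nat) (A : set 'rV[R]_d) : \bar R :=
  limf_esup (box_ratio A) (0 : R)^'+.

Definition has_box_dim (R : realType) (d : nat) (A : set 'rV[R]_d)
    (v : \bar R) : Prop :=
  lower_box_dim A = v /\ upper_box_dim A = v.

(* Vertices are finite words over 'I_M, the root being the empty word; the
   edge (v, i) joins v to its i-th child [rcons v i]. *)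
Definition edge (M : nat) : Type := (seq 'I_M * 'I_M)%type.

(* Edges along a path are numbered from 0. *)
Definition root_path (M : nat) (Q : nat -> edge M) : Prop :=
  (Q 0%N).1 = [::] /\ forall k, (Q k.+1).1 = rcons (Q k).1 (Q k).2.

Definition path_point (R : realType) (N d M : nat)
    (f : 'I_N -> 'rV[R]_d -> 'rV[R]_d) (w : edge M -> 'I_N)
    (Q : nat -> edge M) (n : nat) : 'rV[R]_d :=
  foldr (fun k y => f (w (Q k)) y) 0 (iota 0 n).

Definition limit_set (R : realType) (N d M : nat)
    (f : 'I_N -> 'rV[R]_d -> 'rV[R]_d) (w : edge M -> 'I_N) : set 'rV[R]_d :=
  [set x | exists Q, root_path Q /\ path_point f w Q n @[n --> \oo] --> x].

(* V carries the sigma-algebra of all its subsets. *)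
Definition discrete_rv (disp : measure_display) (T : measurableType disp)
    (V : Type) (X : T -> V) : Prop :=
  forall A : set V, measurable (X @^-1` A).

Definition mutually_independent (R : realType) (disp : measure_display)
    (T : measurableType disp) (P : probability T R) (I : eqType) (V : Type)
    (X : I -> T -> V) : Prop :=
  forall (s : seq I) (A : I -> set V), uniq s ->
    P (\bigcap_(e in [set` s]) (X e @^-1` A e)) =
    (\prod_(e <- s) P (X e @^-1` A e))%E.

Definition random_labelling (R : realType) (N M : nat) (disp : measure_display)
    (T : measurableType disp) (P : probability T R) (p : 'I_N -> R)
    (omega : edge M -> T -> 'I_N) : Prop :=
  [/\ (forall e, discrete_rv (omega e)),
      mutually_independent P omega &
      (forall e i, P [set t | omega e t = i] = (p i)%:E)].

(* The convention 0 log 0 = 0 is automatic, since [ln] is total. *)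
Definition psi (R : realType) (N : nat) (x : 'I_N -> R) : R :=
  \sum_(i < N) x i * (ln (\sum_(j < N) x j) - ln (x i)).

Definition phi (R : realType) (N M : nat) (p : 'I_N -> R) (x : 'I_N -> R) : R :=
  \sum_(i < N) x i * ln (M%:R * p i).

Definition hfun (R : realType) (N : nat) (r : 'I_N -> R) (x : 'I_N -> R) : R :=
  - \sum_(i < N) x i * ln (r i).

Definition is_maximum (R : realType) (S : set R) (v : R) : Prop :=
  S v /\ ubound S v.

(* Main.v *)
Require Import Defs.
From mathcomp Require Import all_boot all_order all_algebra.
From mathcomp Require Import all_classical all_reals all_analysis.
From mathcomp Require Import ring lra.

Import Order.TTheory GRing.Theory Num.Theory.
Import numFieldNormedType.Exports.

Local Open Scope classical_set_scope.
Local Open Scope ring_scope.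

(** Read the labels along the paths of the tree: the words over the alphabet of
    the maps that occur are said to be present. The limit set is coded by the
    infinite words all of whose prefixes are present, and a word of type n (the
    vector of its letter counts) has a cylinder of size exp(- h(n)). There are
    exp(psi(n)) words of type n, up to factors polynomial in the length, and the
    expected number of paths along which a given one is read is exp(phi(n)). So
    the expected number of present words of type n should be
    exp(psi(n) + min(0, phi(n))), and the exponent of this number against the
    size exp(- h(n)) is to be maximized. By homogeneity the maximum v over the
    slice h = 1 controls all types.

    Upper bound. The number of words of type n is at most exp(psi(n))
    ([size_type_class_le]), and the union bound gives the probability
    exp(min(0, phi(n))) for the presence of each ([Pr_present_le]). Since there
    are polynomially many types, the sum of ratio(x)^s over the present words x
    has finite expectation for every s > v ([expected_mass]), hence is almost
    surely finite ([mass_bounded]). The present words of ratio comparable with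
    delta therefore provide O(delta^(-s)) covering sets ([covering_bound]), which
    bounds the upper box dimension and the Hausdorff dimension.

    Lower bound. Given 0 < s < v, a maximizer is approximated by an integer vector
    n, and the words of type n are concatenated into a finite family W of words
    that have the same length and the same ratio rho. The partial products of
    M p_i along such a word do not deviate much from a geometric progression, so
    that the second moment method, applied letter by letter
    ([pairwise_union], [Pr_present_ge]), shows that the expected number of present
    words of W is at least 2 lam, where lam = rho^(-s) ([rich_family]). The tree
    of present concatenations of words of W thus dominates a supercritical
    branching process. Instead of its martingale limit one considers the maximal
    flow through it when the vertices of generation l have capacity lam^(-l): by
    a second moment computation its expectation stays bounded below as the number
    of generations grows ([flow_expectation]). Different subtrees being
    independent, the flow is almost surely positive from some vertex on
    ([flow_survives]).

    By the open set condition, a set of the size of the cylinders of generation i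
    comes close to boundedly many of them ([few_cylinders]), whose capacities are
    comparable with the s-th power of its diameter. If a cover of the limit set
    had small total weight, it would consequently block less than the whole flow.
    Descending through children for which this remains true gives an infinite
    path ([avoiding_path]) whose limit point is in no set of the cover. So the
    s-dimensional content is positive ([content_lower]), which bounds the
    Hausdorff dimension and the lower box dimension from below. *)

Set Implicit Arguments.
Unset Strict Implicit.
Unset Printing Implicit Defensive.

(** * The variational problem *)

Lemma rV_norm_le (R : realType) (d : nat) (z : 'rV[R]_d) (m : R) : 0 <= m ->
  `|z| <= m <-> forall i, `|z ord0 i| <= m.
Proof.
move=> m0; rewrite [`|z|]/Num.Def.normr/= mx_normrE; split => [h i|h].
  by have /bigmax_leP[_ /(_ (ord0, i) isT)] := h.
by apply/bigmax_leP; split => // -[j i] _ /=; rewrite ord1.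
Qed.

(** Only continuity at 0 is at stake, where |x ln x| <= 2 sqrt x. For negative x
    the function vanishes since [ln] does. *)
Lemma continuous_xlnx (R : realType) : continuous (fun x : R => x * ln x).
Proof.
have bound (x : R) : x <= 1 -> `|x * ln x| <= 2 * Num.sqrt x.
  move=> x1; have [x0|x0] := leP x 0.
    by rewrite ln0 // mulr0 normr0 mulr_ge0 // sqrtr_ge0.
  have s0 : 0 < Num.sqrt x by rewrite sqrtr_gt0.
  have := ln_sublinear (_ : 0 < (Num.sqrt x)^-1); rewrite invr_gt0 s0 => /(_ isT).
  rewrite lnV ?posrE // => ls.
  have xE : x = Num.sqrt x ^+ 2 by rewrite sqr_sqrtr // ltW.
  have lnE : ln x = 2 * ln (Num.sqrt x) by rewrite {1}xE lnXn ?posrE// mulr_natl.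
  rewrite ler0_norm; last by rewrite mulr_ge0_le0 ?ln_le0// ltW.
  rewrite lnE {1}xE.
  have -> : 2 * Num.sqrt x = Num.sqrt x ^+ 2 * (2 * (Num.sqrt x)^-1).
    by field; rewrite gt_eqF.
  by rewrite -mulrN ler_wpM2l ?sqr_ge0// -mulrN ler_wpM2l// ltW.
move=> x; have [x0|x0|->] := ltgtP x 0.
- rewrite /continuous_at (ln0 (ltW x0)) mulr0.
  apply: cvg_near_cst; near=> y; rewrite ln0 ?mulr0//; apply: ltW; near: y.
  exact: lt_nbhsl.
- by apply: cvgM; [exact: cvg_id | exact: continuous_ln].
- rewrite /continuous_at mul0r; apply/cvgr0Pnorm_le => e e0.
  have sq : 2 * Num.sqrt y @[y --> (0:R)] --> (0:R).
    have E : 2 * Num.sqrt 0 = 0 :> R by rewrite sqrtr0 mulr0.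
    rewrite -[X in _ --> X]E.
    by apply: cvgM; [exact: cvg_cst | exact: sqrt_continuous].
  move/cvgr0Pnorm_le : sq => /(_ e e0) sq.
  near=> y; apply: le_trans (bound y _) _.
    by apply: ltW; near: y; apply: lt_nbhsl.
  by apply: le_trans (ler_norm _) _; near: y.
Unshelve. all: by end_near.
Qed.

Definition rate (R : realType) (N M : nat) (p x : 'I_N -> R) : R :=
  psi x + Num.min 0 (phi M p x).

(** In this form psi is visibly continuous up to the boundary of the orthant. *)
Lemma psiE (R : realType) (N : nat) (x : 'I_N -> R) :
  psi x = (\sum_i x i) * ln (\sum_i x i) - \sum_i x i * ln (x i).
Proof.
rewrite /psi; under eq_bigr do rewrite mulrBr.
by rewrite sumrB -mulr_suml.
Qed.

Lemma psiZ (R : realType) (N : nat) (c : R) (x : 'I_N -> R) :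
  0 <= c -> (forall i, 0 <= x i) -> psi (fun i => c * x i) = c * psi x.
Proof.
rewrite le_eqVlt => /predU1P[<- _|c0 x0].
  by rewrite mul0r /psi big1// => i _; rewrite !mul0r.
rewrite /psi mulr_sumr; apply: eq_bigr => i _.
have := x0 i; rewrite le_eqVlt => /predU1P[<-|xi0].
  by rewrite !(mulr0, mul0r).
have S0 : 0 < \sum_j x j.
  by rewrite (bigD1 i)//= ltr_wpDr// sumr_ge0.
by rewrite -mulr_sumr !lnM ?posrE// -mulrA; congr (_ * (_ * _)); ring.
Qed.

Lemma phiZ (R : realType) (N M : nat) (p : 'I_N -> R) (c : R) (x : 'I_N -> R) :
  phi M p (fun i => c * x i) = c * phi M p x.
Proof. by rewrite /phi mulr_sumr; apply: eq_bigr => i _; rewrite mulrA. Qed.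

Lemma hfunZ (R : realType) (N : nat) (r : 'I_N -> R) (c : R) (x : 'I_N -> R) :
  hfun r (fun i => c * x i) = c * hfun r x.
Proof.
by rewrite /hfun mulrN mulr_sumr; congr (- _); apply: eq_bigr => i _; rewrite mulrA.
Qed.

Lemma rateZ (R : realType) (N M : nat) (p : 'I_N -> R) (c : R) (x : 'I_N -> R) :
  0 <= c -> (forall i, 0 <= x i) -> rate M p (fun i => c * x i) = c * rate M p x.
Proof.
move=> c0 x0; rewrite /rate psiZ// phiZ mulrDr; congr (_ + _).
by rewrite -{1}(mulr0 c) minr_pMr.
Qed.

Section variational.
Variables (R : realType) (N M : nat) (r p : 'I_N -> R).
Hypotheses (N2 : (2 <= N)%N) (M2 : (2 <= M)%N).
Hypotheses (r01 : forall i, 0 < r i < 1) (p01 : forall i, 0 < p i < 1).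
Hypothesis p1 : \sum_i p i = 1.

Let lnr_gt0 i : 0 < - ln (r i).
Proof. by have /andP[? ?] := r01 i; rewrite oppr_gt0 ln_lt0 ?posrE//; apply/andP. Qed.

Lemma hfunE (x : 'I_N -> R) : hfun r x = \sum_i x i * - ln (r i).
Proof. by rewrite /hfun -sumrN; apply: eq_bigr => i _; rewrite mulrN. Qed.

Lemma hfun_ge (x : 'I_N -> R) i : (forall i, 0 <= x i) ->
  x i * - ln (r i) <= hfun r x.
Proof.
move=> x0; rewrite hfunE (bigD1 i)//= lerDl sumr_ge0// => j _.
by rewrite mulr_ge0// ltW.
Qed.

Lemma hfun_ge0 (x : 'I_N -> R) : (forall i, 0 <= x i) -> 0 <= hfun r x.
Proof. by move=> x0; rewrite hfunE sumr_ge0// => j _; rewrite mulr_ge0// ltW. Qed.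

Lemma hfun_eq0 (x : 'I_N -> R) : (forall i, 0 <= x i) -> hfun r x = 0 ->
  forall i, x i = 0.
Proof.
move=> x0 hx i; apply/eqP; rewrite eq_le x0 andbT.
by rewrite -(pmulr_lle0 _ (lnr_gt0 i)) -hx hfun_ge.
Qed.

Let ev (i : 'I_N) (z : 'rV[R]_N) : R := z ord0 i.

Let ev_cont i : continuous (ev i).
Proof. exact: coord_continuous. Qed.

Let sum_cont (g : 'I_N -> 'rV[R]_N -> R) : (forall i, continuous (g i)) ->
  continuous (fun z => \sum_i g i z).
Proof.
by move=> gc; apply: continuous_big => //; exact: add_continuous.
Qed.

Let scale_cont (c : 'I_N -> R) : continuous (fun z => \sum_i ev i z * c i).
Proof.
apply: sum_cont => i z.
by apply: (@continuousM _ _ (ev i) (cst (c i)) z); [exact: ev_cont | exact: cst_continuous].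
Qed.

Lemma hfun_cont : continuous (fun z : 'rV[R]_N => hfun r (fun i => z ord0 i)).
Proof.
move=> z; apply: (@continuousN _ _ _ (fun z => \sum_i ev i z * ln (r i))).
exact: scale_cont.
Qed.

Lemma rate_cont : continuous (fun z : 'rV[R]_N => rate M p (fun i => z ord0 i)).
Proof.
pose S z := \sum_i ev i z; pose Z z := \sum_i ev i z * ln (ev i z).
pose F z := \sum_i ev i z * ln (M%:R * p i).
have -> : (fun z : 'rV[R]_N => rate M p (fun i => z ord0 i)) =
    (fun z => (S z * ln (S z) - Z z) + (cst 0 \min F) z).
  by apply/funext => z; rewrite /rate psiE.
move=> z; apply: (@continuousD _ _ _ (fun z => S z * ln (S z) - Z z)); last first.
  apply: continuous_min; [exact: cst_continuous | exact: scale_cont].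
apply: (@continuousB _ _ _ (fun z => S z * ln (S z)) Z).
  apply: (@continuous_comp _ _ _ S (fun x => x * ln x)).
    by apply: sum_cont => i; exact: ev_cont.
  exact: continuous_xlnx.
move: z; apply: sum_cont => i y.
apply: (@continuous_comp _ _ _ (ev i) (fun x => x * ln x)).
  exact: ev_cont.
exact: continuous_xlnx.
Qed.

Let x0 : 'I_N -> R := fun i => (hfun r p)^-1 * p i.

Let p0 i : 0 < p i. Proof. by have /andP[] := p01 i. Qed.

Let hp_gt0 : 0 < hfun r p.
Proof.
have i : 'I_N by exact: (Ordinal (ltn_trans (ltnSn 0) N2)).
apply: lt_le_trans (hfun_ge i _); last by move=> j; rewrite ltW.
by rewrite mulr_gt0.
Qed.

(** The law of the labels is a competitor with positive value: its entropy is
    positive, and adding the mean of log(M p) to it gives log M. *)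
Lemma rate_p_gt0 : 0 < rate M p p.
Proof.
have i0 : 'I_N := Ordinal (ltn_trans (ltnSn 0) N2).
have lnp i : ln (p i) < 0 by apply: ln_lt0; exact: p01.
have psi0 : 0 < psi p.
  rewrite psiE p1 ln1 mulr0 add0r -sumrN (bigD1 i0)//=.
  rewrite ltr_pwDl//; first by rewrite -mulrN mulr_gt0// oppr_gt0.
  by rewrite sumr_ge0// => i _; rewrite -mulrN mulr_ge0 ?ltW// oppr_gt0.
have M0 : 0 < M%:R :> R by rewrite ltr0n (leq_trans _ M2).
rewrite /rate /Num.min; case: ifP => _; first by rewrite addr0.
have -> : psi p + phi M p p = ln M%:R.
  rewrite psiE p1 ln1 mulr0 add0r /phi.
  under [X in _ + X]eq_bigr do rewrite lnM ?posrE// mulrDr.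
  by rewrite big_split/= -mulr_suml p1 mul1r addrCA addNr addr0.
by rewrite ln_gt0// ltr1n.
Qed.

Lemma exists_max_rate : exists x, [/\ (forall i, 0 <= x i), hfun r x = 1 &
  (forall y, (forall i, 0 <= y i) -> hfun r y = 1 -> rate M p y <= rate M p x)].
Proof.
pose A := [set z : 'rV[R]_N | (forall i, 0 <= z ord0 i) /\
  hfun r (fun i => z ord0 i) = 1].
have A0 : A !=set0.
  exists (\row_i x0 i); split => [i|].
    by rewrite mxE mulr_ge0 ?invr_ge0 ?ltW.
  have -> : (fun i => (\row_i x0 i) ord0 i) = x0.
    by apply/funext => i; rewrite mxE.
  by rewrite hfunZ mulVf// gt_eqF.
have cA : compact A.
  apply: bounded_closed_compact.
    exists (\sum_i (- ln (r i))^-1); split => [|m mlt z]; first exact: num_real.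
    move=> [z0 hz].
    apply/rV_norm_le => [|i].
      by apply: le_trans (ltW mlt); rewrite sumr_ge0// => i _; rewrite invr_ge0 ltW.
    rewrite ger0_norm//; apply: le_trans (ltW mlt).
    rewrite (bigD1 i)//= ler_wpDr//.
      by rewrite sumr_ge0// => k _; rewrite invr_ge0 ltW.
    rewrite -[X in _ <= X]mul1r ler_pdivlMr//.
    by rewrite -hz; apply: (hfun_ge (x := fun i => z ord0 i) i).
  have -> : A = (\bigcap_i (ev i @^-1` [set x | 0 <= x])) `&`
      ((fun z : 'rV[R]_N => hfun r (fun i => z ord0 i)) @^-1` [set 1]).
    apply/seteqP; split => z /= [z0 hz]; split => // i; first by move=> _; apply: z0.
    exact: (z0 i I).
  apply: closedI.
    apply: closed_bigI => i _.
    apply: (@preimage_closed _ _ (ev i) [set x | 0 <= x]) (@closed_ge _ 0).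
    by move=> z _; exact: ev_cont.
  apply: preimage_closed; last exact: closed_eq.
  by move=> z _; exact: hfun_cont.
have [c /set_mem[c0 hc] cmax] := EVT_max_rV A0 cA
  (continuous_subspaceT rate_cont).
exists (fun i => c ord0 i); split => // y y0 hy.
have E : (fun i => (\row_i y i) ord0 i) = y by apply/funext => i; rewrite mxE.
rewrite -{1}E; apply: cmax; apply/mem_set.
by rewrite /A /= E; split => // i; rewrite mxE.
Qed.

Lemma max_rate_gt0 v : (forall y, (forall i, 0 <= y i) -> hfun r y = 1 -> rate M p y <= v) ->
  0 < v.
Proof.
move=> vmax; apply: lt_le_trans (vmax x0 _ _).
- rewrite rateZ ?invr_ge0 ?(ltW hp_gt0)//; last by move=> i; rewrite ltW.
  by rewrite mulr_gt0 ?invr_gt0// rate_p_gt0.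
- by move=> i; rewrite mulr_ge0 ?invr_ge0 ?ltW.
- by rewrite hfunZ mulVf// gt_eqF.
Qed.

(** By homogeneity, the maximum over the slice controls the whole cone. *)
Lemma rate_le v (x : 'I_N -> R) :
  (forall y, (forall i, 0 <= y i) -> hfun r y = 1 -> rate M p y <= v) ->
  (forall i, 0 <= x i) -> rate M p x <= v * hfun r x.
Proof.
move=> vmax xge0; have := hfun_ge0 xge0; rewrite le_eqVlt => /predU1P[h0|h0].
  have xE : x = fun i => 0 * x i.
    by apply/funext => i; rewrite mul0r (hfun_eq0 xge0).
  by rewrite -h0 mulr0 xE rateZ// mul0r.
have hi0 : 0 <= (hfun r x)^-1 by rewrite invr_ge0 ltW.
rewrite -ler_pdivrMr// mulrC -rateZ//; apply: vmax.
  by move=> i; rewrite mulr_ge0.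
by rewrite hfunZ mulVf// gt_eqF.
Qed.

End variational.

(** * Counting words of a given type *)

Section words.
Variable N : nat.
Implicit Types (w : seq 'I_N) (n : 'I_N -> nat).

Fixpoint allwords (k : nat) : seq (seq 'I_N) :=
  if k is k'.+1 then [seq i :: w | i <- enum 'I_N, w <- allwords k'] else [:: [::]].

Lemma big_allwordsS (T : Type) (idx : T) (op : Monoid.com_law idx) k
    (P : pred (seq 'I_N)) (F : seq 'I_N -> T) :
  \big[op/idx]_(w <- allwords k.+1 | P w) F w =
  \big[op/idx]_i \big[op/idx]_(w <- allwords k | P (i :: w)) F (i :: w).
Proof.
rewrite /= big_mkcond big_allpairs_dep/= big_enum/=.
by apply: eq_bigr => i _; rewrite [RHS]big_mkcond.
Qed.

Lemma mem_allwords k w : (w \in allwords k) = (size w == k).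
Proof.
elim: k w => [|k IH] [|i w] //=; rewrite ?inE//.
  by apply/allpairsP => -[[? ?] []].
rewrite eqSS -IH; apply/allpairsP/idP => [[[j x] /= [_ xw [_ wx]]]|ww]; first by rewrite wx.
by exists (i, w); rewrite mem_enum.
Qed.

Lemma allwords_uniq k : uniq (allwords k).
Proof.
elim: k => //= k IH; apply: allpairs_uniq => //; first exact: enum_uniq.
by move=> [i w] [j x] _ _ /= [-> ->].
Qed.

Definition of_type n w := [forall i, count_mem i w == n i].

Lemma of_typeP n w : reflect (forall i, count_mem i w = n i) (of_type n w).
Proof. exact: 'forall_eqP. Qed.

Lemma size_of_type n w : of_type n w -> size w = (\sum_i n i)%N.
Proof.
move=> /of_typeP nw; under eq_bigr do rewrite -nw.
elim: w {nw} => [|i w IH] /=; first by rewrite big1.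
by rewrite big_split/= -IH (bigD1 i)//= eqxx big1// => j /negPf; rewrite eq_sym => ->.
Qed.

Definition type_class n := [seq w <- allwords (\sum_i n i)%N | of_type n w].

Lemma mem_type_class n w : (w \in type_class n) = of_type n w.
Proof.
rewrite mem_filter mem_allwords; case E : (of_type n w) => //=.
by rewrite (size_of_type E) eqxx.
Qed.

Lemma type_class_uniq n : uniq (type_class n).
Proof. by rewrite filter_uniq// allwords_uniq. Qed.

Let decr n i : 'I_N -> nat := fun j => (n j - (i == j))%N.

Lemma of_type_cons n i w :
  of_type n (i :: w) = (0 < n i)%N && of_type (decr n i) w.
Proof.
apply/of_typeP/andP => /= [nw|[ni /of_typeP nw] j].
  split; first by rewrite -nw eqxx.
  by apply/of_typeP => j; rewrite /decr -nw addKn.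
by rewrite nw /decr; case: (eqVneq i j) => [<-|_]; rewrite ?subnKC// subn0.
Qed.

(** The multinomial coefficient, obtained by removing the first letter. *)
Lemma size_type_class n :
  (size (type_class n) * \prod_i (n i)`! = (\sum_i n i)`!)%N.
Proof.
rewrite /type_class size_filter.
suff H k n' : (\sum_i n' i)%N = k ->
    (count (of_type n') (allwords k) * \prod_i (n' i)`! = k`!)%N by exact: H.
move: {n} n' => n; elim: k n => [|k IH] n nk.
  have n0 i : n i = 0%N.
    by apply/eqP; rewrite -leqn0 -nk (bigD1 i)//= leq_addr.
  rewrite /= addn0 big1 => [|i _]; last by rewrite n0.
  suff -> : of_type n [::] by [].
  by apply/of_typeP => i; rewrite n0.
rewrite -sum1_count big_allwordsS big_distrl/= factS -nk big_distrl/=.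
apply: eq_bigr => i _.
under eq_bigl do rewrite of_type_cons.
case: (posnP (n i)) => [->|ni] /=; first by rewrite big_pred0// mul0n.
have kE : (\sum_j decr n i j)%N = k.
  apply: succn_inj; rewrite -nk [RHS](bigD1 i)//= (bigD1 i)//= /decr eqxx.
  rewrite -addSn subn1 prednK//; congr addn.
  by apply: eq_bigr => j /negPf; rewrite eq_sym => ->; rewrite subn0.
rewrite -(IH _ kE) sum1_count (bigD1 i)//= [in RHS](bigD1 i)//=.
have -> : decr n i i = (n i).-1 by rewrite /decr eqxx subn1.
have -> : (n i)`! = (n i * (n i).-1`!)%N by rewrite -{1}(prednK ni) factS prednK.
rewrite -!mulnA mulnCA; congr (_ * (_ * (_ * _)))%N.
by apply: eq_bigr => j /negPf; rewrite /decr eq_sym => ->; rewrite subn0.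
Qed.

Variable R : realType.

Lemma big_word (T : Type) (idx : T) (op : Monoid.com_law idx) w (F : 'I_N -> T) :
  \big[op/idx]_(i <- w) F i = \big[op/idx]_i iterop (count_mem i w) op (F i) idx.
Proof.
elim: w => [|j w IH]; first by rewrite big_nil big1.
rewrite big_cons IH [RHS](bigD1 j)//= eqxx [in LHS](bigD1 j)//= Monoid.mulmA.
congr (op _ _).
  by case: (count_mem j w) => [|c] //=; rewrite Monoid.mulm1.
by apply: eq_bigr => i; rewrite eq_sym => /negPf ->.
Qed.

Lemma prod_word (g : 'I_N -> R) w :
  \prod_(i <- w) g i = \prod_i g i ^+ count_mem i w.
Proof. by rewrite big_word. Qed.

Lemma sum_prod_allwords (g : 'I_N -> R) k :
  \sum_(w <- allwords k) \prod_(i <- w) g i = (\sum_i g i) ^+ k.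
Proof.
elim: k => [|k IH]; first by rewrite /= big_seq1 big_nil expr0.
rewrite big_allwordsS exprS mulr_suml; apply: eq_bigr => i _.
by rewrite -IH mulr_sumr; apply: eq_bigr => w _; rewrite big_cons.
Qed.

Definition type_vec n : 'I_N -> R := fun i => (n i)%:R.

Lemma type_vec_ge0 n i : 0 <= type_vec n i. Proof. exact: ler0n. Qed.

Lemma sum_type_vec n : \sum_i type_vec n i = (\sum_i n i)%:R.
Proof. by rewrite natr_sum. Qed.

(** Under the product law with marginal n / |n|, each word of type n has
    probability exp(- psi n), and the total probability is one. *)
Lemma size_type_class_le n : (size (type_class n))%:R <= expR (psi (type_vec n)).
Proof.
set k := (\sum_i n i)%N; have [k0|kpos] := posnP k.
  rewrite /type_class -/k k0 /=.
  have -> : psi (type_vec n) = 0.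
    rewrite /psi big1// => i _; suff -> : type_vec n i = 0 by rewrite mul0r.
    by apply/eqP; rewrite pnatr_eq0 -leqn0 -k0 /k (bigD1 i)//= leq_addr.
  by rewrite expR0; case: ifP.
pose q i : R := type_vec n i / k%:R.
have k0 : 0 < k%:R :> R by rewrite ltr0n.
have q1 : \sum_i q i = 1 by rewrite -mulr_suml sum_type_vec divff// gt_eqF.
have := sum_prod_allwords q k; rewrite q1 expr1n => sum1.
rewrite -[leRHS]mul1r -[X in X * _]sum1.
rewrite (bigID (of_type n))/= mulrDl ler_wpDr//.
  rewrite mulr_ge0 ?expR_ge0// sumr_ge0// => w _; rewrite prodr_ge0// => i _.
  by rewrite divr_ge0 ?ler0n.
rewrite mulr_suml -big_filter -/(type_class n).
rewrite (eq_big_seq (fun=> 1)); first by rewrite big_const_seq iter_addr_0 count_predT.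
move=> w; rewrite mem_type_class => /of_typeP nw.
rewrite prod_word -[RHS]expR0 -(addNr (psi (type_vec n))) expRD; congr (_ * _).
rewrite /psi -sumrN expR_sum; apply: eq_bigr => i _; rewrite nw.
have [ni|ni] := posnP (n i); first by rewrite /type_vec ni expr0 mul0r oppr0 expR0.
rewrite sum_type_vec -/k -mulrN opprB -ln_div ?posrE ?ltr0n//.
by rewrite expRM_natl lnK// posrE divr_gt0// ltr0n.
Qed.

Lemma ln_fact_ge m : m%:R * ln m%:R - m%:R <= ln (m`!)%:R :> R.
Proof.
elim: m => [|m IH]; first by rewrite mul0r subr0 fact0 ln1.
rewrite factS natrM lnM ?posrE ?ltr0n ?fact_gt0//.
have -> : m.+1%:R * ln m.+1%:R - m.+1%:R =
    ln m.+1%:R + (m%:R * ln m.+1%:R - m%:R - 1) :> R by rewrite -natr1; ring.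
rewrite lerD2l; apply: le_trans IH.
have [->|m0] := posnP m; first by rewrite !mul0r; lra.
have mR : 0 < m%:R :> R by rewrite ltr0n.
suff : m%:R * (ln m.+1%:R - ln m%:R) <= 1 :> R by lra.
rewrite -ln_div ?posrE ?ltr0n// -natr1 mulrDl divff ?gt_eqF// mul1r.
have iR : 0 < m%:R^-1 :> R by rewrite invr_gt0.
have := @le_ln1Dx R m%:R^-1; rewrite (lt_trans _ iR) ?ltrN10// => /(_ isT) h.
by rewrite mulrC -ler_pdivlMr// mul1r.
Qed.

Lemma ln_fact_le m :
  ln (m`!)%:R <= m%:R * ln m%:R - m%:R + 1 + ln m%:R :> R.
Proof.
case: m => [|m]; first by rewrite fact0 ln1 mul0r ln0//; lra.
elim: m => [|m IH]; first by rewrite factS fact0 mul1n ln1; lra.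
rewrite factS natrM lnM ?posrE ?ltr0n ?fact_gt0//.
set y : R := m.+1%:R; have y0 : 0 < y by rewrite ltr0n.
rewrite -natr1 -/y; have y1 : 0 < y + 1 by lra.
suff : 1 <= (y + 1) * (ln (y + 1) - ln y) by move: IH; rewrite -/y; lra.
have i0 : 0 < (y + 1)^-1 by rewrite invr_gt0.
have i1 : (y + 1)^-1 < 1 by rewrite invf_lt1//; lra.
have h := @le_ln1Dx R (- (y + 1)^-1); rewrite ltrN2 i1 in h.
have {h} := h isT.
have -> : 1 - (y + 1)^-1 = y / (y + 1) by field; rewrite gt_eqF.
rewrite ln_div ?posrE// => h.
by rewrite mulrC -ler_pdivrMr// mul1r; lra.
Qed.

(** Stirling's formula up to factors polynomial in the length. *)
Lemma ln_size_type_class n :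
  psi (type_vec n) - N%:R - \sum_i ln (type_vec n i) <= ln (size (type_class n))%:R.
Proof.
have /(congr1 (fun m => ln m%:R : R)) := size_type_class n.
have fac0 : (0 < \prod_i (n i)`!)%N by rewrite prodn_gt0// => i; exact: fact_gt0.
have s0 : (0 < size (type_class n))%N.
  have := fact_gt0 (\sum_i n i); rewrite -size_type_class.
  by rewrite muln_gt0 => /andP[].
rewrite natrM lnM ?posrE ?ltr0n// => lnE.
have lnprod : ln (\prod_i (n i)`!)%:R = \sum_i ln ((n i)`!)%:R :> R.
  rewrite natr_prod; suff [] : 0 < \prod_i ((n i)`!)%:R :> R /\
      ln (\prod_i ((n i)`!)%:R) = \sum_i ln ((n i)`!)%:R :> R by [].
  elim/big_rec2 : _ => [|i x y _ [x0 xE]]; first by rewrite ln1.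
  by rewrite mulr_gt0 ?lnM ?xE ?posrE ?ltr0n ?fact_gt0.
rewrite -(lerD2r (\sum_i ln ((n i)`!)%:R)) -lnprod lnE.
apply: le_trans (ln_fact_ge _).
rewrite lnprod psiE -!sum_type_vec.
have : \sum_i ln ((n i)`!)%:R <=
    \sum_i (type_vec n i * ln (type_vec n i) - type_vec n i + 1 + ln (type_vec n i)).
  by apply: ler_sum => i _; exact: ln_fact_le.
rewrite !big_split/= sumrN sumr_const card_ord.
lra.
Qed.

End words.

(** * A rich family of words with a common ratio *)

Section rich_words.
Variables (R : realType) (N M : nat) (r p : 'I_N -> R).
Hypotheses (M0 : (0 < M)%N) (r01 : forall i, 0 < r i < 1) (p0 : forall i, 0 < p i).

Lemma natr_gt_bound (x : R) : exists m : nat, (0 < m)%N /\ x < m%:R.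
Proof.
exists (Num.bound x).+1; split => //.
rewrite -natr1 ltr_wpDr//; apply: le_lt_trans (ler_norm x) _.
by have := archi_boundP (normr_ge0 x); rewrite /Num.bound normr_id.
Qed.

(** The type is an integer approximation of a multiple K x of the maximizer. By
    homogeneity the gain over s grows linearly in K, which beats the logarithmic
    error in Stirling's formula. *)
Lemma exists_type s (x : 'I_N -> R) : (forall i, 0 <= x i) -> hfun r x = 1 ->
  s < rate M p x ->
  exists n : 'I_N -> nat, expR (s * hfun r (type_vec R n)) <
    (size (type_class n))%:R * expR (Num.min 0 (phi M p (type_vec R n))).
Proof.
move=> x0 hx sv; set d := (rate M p x - s) / 2.
have d0 : 0 < d by rewrite /d; lra.
pose g (z : 'rV[R]_N) := rate M p (fun i => z ord0 i) - s * hfun r (fun i => z ord0 i).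
pose z := \row_i x i.
have zE : (fun i => z ord0 i) = x by apply/funext => i; rewrite mxE.
have gz : g z = 2 * d by rewrite /g zE hx /d; lra.
have gc : {for z, continuous g}.
  apply: (@continuousB _ _ _ (fun z : 'rV[R]_N => rate M p (fun i => z ord0 i))).
    exact: rate_cont.
  apply: (@continuousM _ _ (cst s) (fun z : 'rV[R]_N => hfun r (fun i => z ord0 i))).
    exact: cst_continuous.
  exact: hfun_cont.
have /nbhs_ballP[e /= e0 eg] : \forall y \near z, d < g y.
  by apply: (gc [set y | d < y]); apply: lt_nbhsr; rewrite gz; lra.
pose X := \sum_i x i + 1.
have X0 i : x i < X.
  by rewrite /X (bigD1 i)//= -addrA ltr_pwDr// ltr_wpDl// sumr_ge0.
have [m [m0 mlt]] := natr_gt_bound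
  (Num.max (e^-1) ((3 * N%:R + N%:R * `|ln X|) / d)).
move: mlt; rewrite gt_max => /andP[me md].
have mR : 1 <= m%:R :> R by rewrite ler1n.
(* With K a square, ln K <= 2 sqrt K makes the comparison quadratic in m. *)
pose K : R := m%:R ^+ 2; have K0 : 0 < K by rewrite /K; nra.
have iK0 : 0 <= K^-1 by rewrite invr_ge0 ltW.
have Km : m%:R <= K by rewrite /K; nra.
pose n i := Num.truncn (K * x i).
have nlt i : type_vec R n i <= K * x i < type_vec R n i + 1.
  by rewrite natr1; apply: truncn_itv; rewrite mulr_ge0// ltW.
exists n; pose y := \row_i (K^-1 * type_vec R n i).
have yE : (fun i => y ord0 i) = fun i => K^-1 * type_vec R n i.
  by apply/funext => i; rewrite mxE.
have yz : ball z e y.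
  rewrite -ball_normE /ball_ /=.
  apply: (@le_lt_trans _ _ K^-1); last first.
    rewrite invf_plt ?posrE//; exact: lt_le_trans Km.
  apply/rV_norm_le => [|i]; first by rewrite invr_ge0 ltW.
  rewrite !mxE; have /andP[n1 n2] := nlt i.
  have -> : x i - K^-1 * type_vec R n i = K^-1 * (K * x i - type_vec R n i).
    by field; rewrite gt_eqF.
  rewrite normrM (ger0_norm iK0) -[leRHS]mulr1.
  by rewrite ler_wpM2l// ger0_norm; lra.
have := eg _ yz; rewrite /= /g yE => gy.
have n0 := type_vec_ge0 R n.
rewrite rateZ ?hfunZ// ?invr_ge0 ?(ltW K0)// in gy.
have {}gy : d * K < rate M p (type_vec R n) - s * hfun r (type_vec R n).
  rewrite -ltr_pdivlMr//; lra.
have err : N%:R + \sum_i ln (type_vec R n i) <= d * K.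
  apply: (@le_trans _ _ (N%:R + \sum_(i < N) (2 * m%:R + `|ln X|))).
    rewrite lerD2l; apply: ler_sum => i _.
    have [ni|ni] := posnP (n i).
      by rewrite /type_vec ni ln0// addr_ge0// mulr_ge0.
    have xi : 0 < x i.
      rewrite lt_neqAle x0 andbT; apply/eqP => xi.
      by move: ni; rewrite /n -xi mulr0 truncn0.
    have /andP[n1 _] := nlt i.
    apply: (@le_trans _ _ (ln (K * X))).
      have np : 0 < type_vec R n i by rewrite ltr0n.
      have KX : K * x i < K * X by rewrite ltr_pM2l.
      by rewrite ler_ln ?posrE//; [lra|nra].
    rewrite lnM ?posrE//; last exact: lt_trans (X0 i).
    rewrite lerD ?ler_norm// lnXn; last by lra.
    have := @ln_sublinear R m%:R; rewrite mulr2n ltr0n m0 => /(_ isT); lra.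
  rewrite sumr_const card_ord -[X in _ + X]mulr_natl.
  rewrite ltr_pdivrMr// in md.
  have : 0 <= N%:R * `|ln X| by rewrite mulr_ge0.
  have : 0 <= N%:R :> R by [].
  move: md; rewrite /K; set a := N%:R * _; set b := N%:R => md b0 a0.
  rewrite mulrDr -/a; nra.
have s0 : 0 < (size (type_class n))%:R :> R.
  rewrite ltr0n; have := fact_gt0 (\sum_i n i); rewrite -size_type_class.
  by rewrite muln_gt0 => /andP[].
rewrite -[X in _ < X * _]lnK ?posrE// -expRD ltr_expR.
have := ln_size_type_class R n.
move: gy; rewrite /rate; lra.
Qed.

(** An upper bound for the reciprocal of the probability that the word is present
    below a vertex. With S the expected number of children that carry the first
    letter and continue with the rest, this probability is at least S / (1 + S),
    which gives the recursion. *)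
Fixpoint den (w : seq 'I_N) : R :=
  if w is i :: w' then 1 + den w' / (M%:R * p i) else 1.

Let Mp i : 0 < M%:R * p i. Proof. by rewrite mulr_gt0// ltr0n. Qed.

Lemma den_ge1 w : 1 <= den w.
Proof.
elim: w => //= i w IH; rewrite lerDl divr_ge0 ?ltW//.
exact: lt_le_trans IH.
Qed.

Lemma den_gt0 w : 0 < den w. Proof. exact: lt_le_trans (den_ge1 w). Qed.

Lemma den_cat w0 w :
  den (w0 ++ w) <= den w0 + (\prod_(i <- w0) (M%:R * p i))^-1 * den w.
Proof.
elim: w0 => [|i w0 IH] /=; first by rewrite big_nil invr1 mul1r lerDr.
rewrite big_cons -addrA lerD2l.
rewrite [X in _ <= X](_ : _ =
    (den w0 + (\prod_(j <- w0) (M%:R * p j))^-1 * den w) / (M%:R * p i)).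
  by rewrite ler_wpM2r// invr_ge0 ltW.
by set Q := \prod_(_ <- _) _; rewrite !invfM; ring.
Qed.

Fixpoint blocks (W0 : seq (seq 'I_N)) (J : nat) : seq (seq 'I_N) :=
  if J is J'.+1 then [seq w0 ++ w | w0 <- W0, w <- blocks W0 J'] else [:: [::]].

Section blocks.
Variables (W0 : seq (seq 'I_N)) (k : nat) (c : R).
Hypotheses (uW0 : uniq W0) (sW0 : forall w, w \in W0 -> size w = k).

Lemma blocks_ind (P : nat -> seq 'I_N -> Prop) :
  P 0%N [::] ->
  (forall J w0 w, w0 \in W0 -> w \in blocks W0 J -> P J w -> P J.+1 (w0 ++ w)) ->
  forall J w, w \in blocks W0 J -> P J w.
Proof.
move=> P0 PS; elim => [|J IH] w; first by rewrite inE => /eqP ->.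
move=> /allpairsP[[w0 w'] /= [w0W wW ->]]; apply: PS => //; exact: IH.
Qed.

Lemma size_blocks J w : w \in blocks W0 J -> size w = (J * k)%N.
Proof.
move: J w; apply: blocks_ind => // J w0 w w0W _ wJ.
by rewrite size_cat wJ sW0// mulSn.
Qed.

Lemma prod_blocks (g : 'I_N -> R) J w :
  (forall w, w \in W0 -> \prod_(i <- w) g i = c) ->
  w \in blocks W0 J -> \prod_(i <- w) g i = c ^+ J.
Proof.
move=> gc; move: J w; apply: blocks_ind => [|J w0 w w0W _ wJ].
  by rewrite big_nil expr0.
by rewrite big_cat/= wJ gc// exprS.
Qed.

Lemma blocks_uniq J : uniq (blocks W0 J).
Proof.
elim: J => //= J IH; apply: allpairs_uniq => // -[w0 w] [v0 v] /=.
move=> /allpairsP[[a a'] /= [aW _ [-> _]]] /allpairsP[[b b'] /= [bW _ [-> _]]].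
by move=> /eqP; rewrite eqseq_cat ?sW0// => /andP[/eqP -> /eqP ->].
Qed.

Lemma size_blocksE J : size (blocks W0 J) = (size W0 ^ J)%N.
Proof. by elim: J => //= J IH; rewrite size_allpairs IH expnS. Qed.

(** The constant A accounts for the fluctuation inside one block, and E for the
    possible decay of the products of M p_i from block to block. *)
Lemma den_blocks (A E : R) : (0 <= E) -> 1 <= A -> c^-1 <= E -> 1 <= E ->
  (forall w, w \in W0 -> \prod_(i <- w) (M%:R * p i) = c) ->
  (forall w, w \in W0 -> den w <= A) ->
  forall J w, w \in blocks W0 J -> den w <= A * J.+1%:R * E ^+ J.
Proof.
move=> E0 A1 cE E1 prodc denA; apply: blocks_ind => [|J w0 w w0W _ wJ].
  by rewrite /= expr0 !mulr1.
apply: le_trans (den_cat w0 w) _; rewrite prodc//.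
have h1 : c^-1 * den w <= E * (A * J.+1%:R * E ^+ J).
  apply: le_trans (_ : E * den w <= _); last by rewrite ler_wpM2l.
  by rewrite ler_wpM2r// ltW// den_gt0.
have h2 : den w0 <= A * E ^+ J.+1.
  apply: le_trans (denA _ w0W) _; rewrite -[leLHS]mulr1 ler_wpM2l//.
    exact: le_trans A1.
  exact: exprn_ege1.
rewrite -[J.+2%:R]natr1 mulrDr mulr1 mulrDl [leRHS]addrC lerD//.
by apply: le_trans h1 _; rewrite exprS; lra.
Qed.

End blocks.

Lemma exponential_beats_linear (q a : R) : 1 < q ->
  exists J : nat, (0 < J)%N /\ a * J.+1%:R <= q ^+ J.
Proof.
move=> q1; pose t := q - 1; have t0 : 0 < t by rewrite /t; lra.
have [m [m0 mlt]] := natr_gt_bound (3 * `|a| / t ^+ 2).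
exists (m.*2); split; first by rewrite double_gt0.
have bern : 1 + m%:R * t <= q ^+ m.
  elim: m {m0 mlt} => [|m IH]; first by rewrite mul0r addr0 expr0.
  rewrite exprS -natr1; have mn : 0 <= m%:R :> R by [].
  have qm : q * (1 + m%:R * t) <= q * q ^+ m by rewrite ler_wpM2l//; lra.
  apply: le_trans qm; have -> : q = 1 + t by rewrite /t; ring.
  by have := mulr_ge0 mn (sqr_ge0 t); rewrite expr2; lra.
have m1 : 1 <= m%:R :> R by rewrite ler1n.
rewrite ltr_pdivrMr ?exprn_gt0// in mlt.
have la := ler_norm a; have na := normr_ge0 a.
have -> : (m.*2).+1%:R = 2 * m%:R + 1 :> R by rewrite -natr1 -mul2n natrM.
rewrite -addnn exprD.
apply: le_trans (_ : (1 + m%:R * t) * (1 + m%:R * t) <= _); last first.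
  by apply: ler_pM => //; nra.
move: bern mlt m1 la na; set y := m%:R; set b := `|a| => _ mlt m1 la na.
have h1 : a * (2 * y + 1) <= b * (3 * y) by nra.
have h2 : 3 * b * y <= y * t ^+ 2 * y by rewrite ler_pM2r; lra.
have h3 : 0 <= y * t by nra.
by move: h2; rewrite expr2; nra.
Qed.

(** For every s below the value of the variational problem there are words of a
    common length K and a common ratio rho that are so many and so likely that
    their expected number exceeds rho^(-s): concatenate a fixed supply of words
    of a well-chosen type. Since all words of the type have the same weight,
    the partial products of M p_i along a concatenation drift linearly, up to
    the fixed fluctuation within a block, and [den] is controlled. *)
Lemma rich_family s (x : 'I_N -> R) : (forall i, 0 <= x i) -> hfun r x = 1 ->
  s < rate M p x ->
  exists (K : nat) (W : seq (seq 'I_N)) (rho : R),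
    [/\ (0 < K)%N /\ 0 < rho < 1, uniq W, (forall w, w \in W -> size w = K),
        (forall w, w \in W -> \prod_(i <- w) r i = rho) &
        2 * rho `^ (- s) <= \sum_(w <- W) (den w)^-1].
Proof.
move=> x0 hx sv; have [n nE] := exists_type x0 hx sv.
set k := (\sum_i n i)%N; set W0 := type_class n.
set h := hfun r (type_vec R n) in nE; set f := phi M p (type_vec R n) in nE.
have r0 i : 0 < r i by have /andP[] := r01 i.
have k0 : (0 < k)%N.
  rewrite lt0n; apply/eqP => k0.
  have n0 i : type_vec R n i = 0.
    by apply/eqP; rewrite pnatr_eq0 -leqn0 -k0 /k (bigD1 i)//= leq_addr.
  have h0 : h = 0 by rewrite /h hfunE big1// => i _; rewrite n0 mul0r.
  have f0 : f = 0 by rewrite /f /phi big1// => i _; rewrite n0 mul0r.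
  have := size_type_class_le R n; rewrite {1}/psi big1 ?expR0 => [sz|i _]; last first.
    by rewrite n0 mul0r.
  by move: nE; rewrite h0 f0 mulr0 minxx expR0 mulr1; lra.
have prodE (g : 'I_N -> R) : (forall i, 0 < g i) -> forall w, w \in W0 ->
    \prod_(i <- w) g i = expR (\sum_i type_vec R n i * ln (g i)).
  move=> g0 w; rewrite mem_type_class => /of_typeP nw.
  rewrite prod_word expR_sum; apply: eq_bigr => i _.
  by rewrite nw expRM_natl lnK// posrE.
have sW0 w : w \in W0 -> size w = k.
  by rewrite mem_type_class => /size_of_type.
pose E := expR (- Num.min 0 f).
have E1 : 1 <= E by rewrite -expR0 ler_expR oppr_ge0 ge_min lexx.
pose A := \sum_(w <- W0) den w + 1.
have A1 : 1 <= A.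
  by rewrite lerDr sumr_ge0// => w _; rewrite ltW// den_gt0.
have denA w : w \in W0 -> den w <= A.
  move=> wW; rewrite /A (big_rem w)//= -addrA lerDl addr_ge0// sumr_ge0// => v _.
  by rewrite ltW// den_gt0.
pose q := (size W0)%:R / E / expR (s * h).
have q1 : 1 < q.
  by rewrite ltr_pdivlMr ?expR_gt0// mul1r /E expRN invrK.
have [J [J0 JE]] := exponential_beats_linear (2 * A) q1.
have rJ w : w \in blocks W0 J -> \prod_(i <- w) r i = expR (- h) ^+ J.
  move=> wW; apply: prod_blocks wW => {}w wW; rewrite prodE//.
  by rewrite /h /hfun opprK.
exists (J * k)%N, (blocks W0 J), (expR (- h) ^+ J); split.
- split; first by rewrite muln_gt0 J0.
  rewrite exprn_gt0 ?expR_gt0//= exprn_ilt1 ?expR_ge0 -?lt0n//.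
  rewrite -expR0 ltr_expR oppr_lt0.
  rewrite lt_neqAle eq_sym (hfun_ge0 r01 (type_vec_ge0 R n)) andbT.
  apply/eqP => /(hfun_eq0 r01 (type_vec_ge0 R n)) n0.
  move: k0; rewrite lt0n => /eqP; apply; rewrite /k big1// => i _.
  by apply/eqP; rewrite -(pnatr_eq0 R); apply/eqP; exact: n0.
- exact: blocks_uniq (type_class_uniq n) sW0 J.
- by move=> w; apply: size_blocks.
- exact: rJ.
- apply: (@le_trans _ _ (\sum_(w <- blocks W0 J) (A * J.+1%:R * E ^+ J)^-1)); last first.
    rewrite !big_seq; apply: ler_sum => w wW.
    rewrite lef_pV2 ?posrE ?den_gt0//; last first.
      by rewrite !mulr_gt0 ?exprn_gt0 ?expR_gt0//; exact: lt_le_trans A1.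
    apply: (@den_blocks W0 (expR f)) wW => //; first exact: expR_ge0.
      by rewrite -expRN ler_expR lerN2 ge_min lexx orbT.
    by move=> v vW; rewrite prodE.
  rewrite big_const_seq count_predT iter_addr_0 size_blocksE.
  rewrite -[leRHS]mulr_natl natrX.
  have -> : (expR (- h) ^+ J) `^ (- s) = expR (s * h) ^+ J.
    rewrite -!expRM_natl -expRM; congr expR; ring.
  have AJ : 0 < A * J.+1%:R by rewrite mulr_gt0//; exact: lt_le_trans A1.
  rewrite invfM mulrCA ler_pdivlMl// mulrA [_ * 2]mulrC mulrA.
  rewrite -ler_pdivlMr ?exprn_gt0 ?expR_gt0//.
  by rewrite -!exprVn -!exprMn.
Qed.

End rich_words.

(** * Finite product laws *)

Section product_law.
Variables (R : realType) (N : nat) (p : 'I_N -> R) (i0 : 'I_N).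
Hypotheses (p0 : forall i, 0 <= p i) (p1 : \sum_i p i = 1).
Variables (I : eqType) (D : finType) (emb : D -> I).
Hypothesis emb_inj : injective emb.

Definition extend (a : {ffun D -> 'I_N}) : I -> 'I_N :=
  fun e => if [pick d | emb d == e] is Some d then a d else i0.

Lemma extend_emb (a : {ffun D -> 'I_N}) d : extend a (emb d) = a d.
Proof.
by rewrite /extend; case: pickP => [d' /eqP/emb_inj -> //|/(_ d)]; rewrite eqxx.
Qed.

Lemma extend_ext (a a' : {ffun D -> 'I_N}) e : (forall d, emb d = e -> a d = a' d) ->
  extend a e = extend a' e.
Proof. by move=> aa; rewrite /extend; case: pickP => // d /eqP/aa. Qed.

Definition weight (a : {ffun D -> 'I_N}) : R := \prod_d p (a d).

Lemma weight_ge0 a : 0 <= weight a. Proof. by rewrite prodr_ge0. Qed.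

Lemma sum_weight : \sum_a weight a = 1.
Proof.
rewrite /weight -(bigA_distr_bigA (fun _ i => p i)) /=.
by rewrite big1// => d _.
Qed.

Definition Exp (F : (I -> 'I_N) -> R) : R := \sum_a weight a * F (extend a).

Lemma Exp_cst c : Exp (fun=> c) = c.
Proof. by rewrite /Exp -mulr_suml sum_weight mul1r. Qed.

Lemma ExpZ c F : Exp (fun w => c * F w) = c * Exp F.
Proof. by rewrite /Exp mulr_sumr; apply: eq_bigr => a _; rewrite mulrCA. Qed.

Lemma ExpB F G : Exp (fun w => F w - G w) = Exp F - Exp G.
Proof. by rewrite /Exp -sumrB; apply: eq_bigr => a _; rewrite mulrBr. Qed.

Lemma Exp_sum (J : Type) (s : seq J) (Q : pred J) (F : J -> (I -> 'I_N) -> R) :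
  Exp (fun w => \sum_(j <- s | Q j) F j w) = \sum_(j <- s | Q j) Exp (F j).
Proof. by rewrite /Exp exchange_big; apply: eq_bigr => a _; rewrite mulr_sumr. Qed.

Lemma le_Exp F G : (forall w, F w <= G w) -> Exp F <= Exp G.
Proof. by move=> FG; apply: ler_sum => a _; rewrite ler_wpM2l ?weight_ge0. Qed.

Lemma Exp_ge0 F : (forall w, 0 <= F w) -> 0 <= Exp F.
Proof. by move=> F0; rewrite -(Exp_cst 0); exact: le_Exp. Qed.

Lemma eq_Exp F G : (forall w, F w = G w) -> Exp F = Exp G.
Proof. by move=> FG; congr Exp; apply/funext. Qed.

Definition depends_on (V : Type) (S : pred I) (F : (I -> 'I_N) -> V) :=
  forall w w', (forall e, S e -> w e = w' e) -> F w = F w'.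

(** Two independent copies may exchange their coordinates inside S. The exchange
    preserves the weight of the pair, and afterwards both factors are evaluated
    at the same copy. *)
Lemma Exp_indep (S S' : pred I) F G : depends_on S F -> depends_on S' G ->
  (forall e, S e -> ~~ S' e) -> Exp (fun w => F w * G w) = Exp F * Exp G.
Proof.
move=> SF SG SS'.
pose mix (a b : {ffun D -> 'I_N}) : {ffun D -> 'I_N} :=
  [ffun d => if S (emb d) then a d else b d].
pose swap (ab : {ffun D -> 'I_N} * {ffun D -> 'I_N}) := (mix ab.1 ab.2, mix ab.2 ab.1).
have swapK : involutive swap.
  move=> [a b]; congr pair; apply/ffunP => d; rewrite !ffunE;
  by case: ifP => S_d; rewrite ?ffunE ?S_d.
have swapW ab : weight (swap ab).1 * weight (swap ab).2 = weight ab.1 * weight ab.2.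
  rewrite /weight -!big_split; apply: eq_bigr => d _ /=; rewrite !ffunE.
  by case: ifP => // _; rewrite mulrC.
transitivity (\sum_(ab : {ffun D -> 'I_N} * {ffun D -> 'I_N})
    weight ab.1 * weight ab.2 * (F (extend ab.1) * G (extend ab.1))).
  rewrite -(pair_bigA _ (fun a b => weight a * weight b *
    (F (extend a) * G (extend a))))/=.
  apply: eq_bigr => a _; rewrite -mulr_suml; congr (_ * _).
  by rewrite -mulr_sumr sum_weight mulr1.
rewrite (reindex_inj (inv_inj swapK)) /Exp mulr_suml.
under [RHS]eq_bigr do rewrite mulr_sumr.
rewrite pair_bigA; apply: eq_bigr => -[a b] _; rewrite swapW/= mulrACA.
congr (_ * _ * (_ * _)).
  by apply: SF => e Se; apply: extend_ext => d de; rewrite ffunE de Se.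
apply: SG => e Se; apply: extend_ext => d de; rewrite ffunE de.
by case: ifP => // /SS'; rewrite Se.
Qed.

Lemma Exp_edge d i : Exp (fun w => (w (emb d) == i)%:R) = p i.
Proof.
rewrite /Exp; under eq_bigr do rewrite extend_emb.
pose F d' j := p j * (if d' == d then (j == i)%:R else 1).
transitivity (\sum_(a : {ffun D -> 'I_N}) \prod_d' F d' (a d')).
  apply: eq_bigr => a _; rewrite /F big_split/=; congr (_ * _).
  by rewrite -big_mkcond big_pred1_eq.
rewrite -bigA_distr_bigA (bigD1 d)//= [X in _ * X]big1 ?mulr1 => [|d' /negPf dd].
  rewrite (bigD1 i)//= big1 => [|j /negPf ji]; rewrite /F eqxx ?ji ?mulr0//.
  by rewrite eqxx mulr1 addr0.
by rewrite /F dd; under eq_bigr do rewrite mulr1.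
Qed.

Section law.
Variables (disp : measure_display) (T : measurableType disp) (P : probability T R).
Variable omega : I -> T -> 'I_N.
Hypotheses (mom : forall e, discrete_rv (omega e)).
Hypothesis iom : mutually_independent P omega.
Hypothesis lom : forall e i, P [set t | omega e t = i] = (p i)%:E.

Let cell (a : {ffun D -> 'I_N}) := [set t | forall d, omega (emb d) t = a d].

Let cellE a : cell a =
  \bigcap_(e in [set` [seq emb d | d : D]]) (omega e @^-1` [set extend a e]).
Proof.
apply/seteqP; split => t ta.
  by move=> e /mapP[d _ ->] /=; rewrite extend_emb ta.
by move=> d; rewrite -(extend_emb a); apply: ta; rewrite /= map_f ?mem_enum.
Qed.

Let measurable_cell a : measurable (cell a).
Proof.
rewrite cellE; apply: fin_bigcap_measurable; first exact: finite_seq.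
by move=> e _; exact: mom.
Qed.

Let P_cell a : P (cell a) = (weight a)%:E.
Proof.
rewrite cellE iom; last by rewrite map_inj_uniq ?enum_uniq.
rewrite big_map big_enum/= /weight -prodEFin; apply: eq_bigr => d _.
by rewrite extend_emb lom.
Qed.

(** An event that depends on finitely many labels is the disjoint union of the
    cells on which these labels are prescribed. *)
Lemma law_of_labels (A : (I -> 'I_N) -> bool) :
  depends_on [pred e | [exists d, emb d == e]] A ->
  measurable [set t | A (omega ^~ t)] /\
  P [set t | A (omega ^~ t)] = (Exp (fun w => (A w)%:R))%:E.
Proof.
move=> dA; pose s := [seq a <- enum {ffun D -> 'I_N} | A (extend a)].
have E : [set t | A (omega ^~ t)] = \bigcup_(a in [set` s]) cell a.
  apply/seteqP; split => t /=.
    move=> At; exists [ffun d => omega (emb d) t]; last by move=> d; rewrite ffunE.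
    rewrite /= mem_filter mem_enum andbT -(dA (omega ^~ t))// => e /existsP[d /eqP <-].
    by rewrite extend_emb ffunE.
  move=> [a /=]; rewrite mem_filter => /andP[Aa _] ta.
  by rewrite (dA _ (extend a))// => e /existsP[d /eqP <-]; rewrite extend_emb.
rewrite E; split.
  by apply: fin_bigcup_measurable => [|a _]; [exact: finite_seq | exact: measurable_cell].
rewrite measure_fin_bigcup; first last.
- by move=> a _; exact: measurable_cell.
- by move=> a b _ _ [t [ta tb]]; apply/ffunP => d; rewrite -ta -tb.
- exact: finite_seq.
rewrite -fsbig_seq; last by rewrite filter_uniq// -?enumT enum_uniq.
rewrite (eq_bigr (fun a => (weight a)%:E)) => [|a _]; last exact: P_cell.
rewrite sumEFin big_filter big_enum_cond/= /Exp big_mkcond; congr EFin.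
by apply: eq_bigr => a _; case: (A _); rewrite ?mulr1 ?mulr0.
Qed.

End law.
End product_law.

(** * Words read in a labelled tree *)

Section labelled_tree.
Variables (N M : nat).
Implicit Types (w : edge M -> 'I_N) (u v : seq 'I_M) (x : seq 'I_N).

Fixpoint read w u v : seq 'I_N :=
  if v is c :: v' then w (u, c) :: read w (rcons u c) v' else [::].

Fixpoint present w u x : bool :=
  if x is i :: x' then [exists c, (w (u, c) == i) && present w (rcons u c) x']
  else true.

(** One path along which x is read. The choice involves only the labels of the
    first |x| generations below u, and is thus independent of the subtrees
    that hang off the end of the path. *)
Fixpoint rep w u x : seq 'I_M :=
  if x is i :: x' then
    if [pick c | (w (u, c) == i) && present w (rcons u c) x'] is Some c
    then c :: rep w (rcons u c) x' else [::]
  else [::].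

Lemma size_read w u v : size (read w u v) = size v.
Proof. by elim: v u => //= c v IH u; rewrite IH. Qed.

Lemma read_cat w u v v' : read w u (v ++ v') = read w u v ++ read w (u ++ v) v'.
Proof. by elim: v u => [|c v IH] u /=; rewrite ?cats0// IH cat_rcons. Qed.

Lemma present_read w u v : present w u (read w u v).
Proof. by elim: v u => //= c v IH u; apply/existsP; exists c; rewrite eqxx IH. Qed.

Lemma read_rep w u x : present w u x -> read w u (rep w u x) = x.
Proof.
elim: x u => //= i x IH u /existsP[c cP]; case: pickP => [d|/(_ c)]; last by rewrite cP.
by move=> /andP[/eqP wd dx] /=; rewrite wd IH.
Qed.

Lemma size_rep w u x : present w u x -> size (rep w u x) = size x.
Proof. by move=> /read_rep xE; rewrite -{2}xE size_read. Qed.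

Definition block u (k : nat) : pred (edge M) :=
  [pred e | prefix u e.1 && (size e.1 < size u + k)%N].

Lemma block_rcons u c k e : block (rcons u c) k e -> block u k.+1 e.
Proof.
rewrite /block /= size_rcons addSnnS => /andP[pe ->]; rewrite andbT.
exact: prefix_trans (prefix_rcons u c) pe.
Qed.

Lemma block_root u c k : block u k.+1 (u, c).
Proof. by rewrite /block /= prefix_refl addnS ltnS leq_addr. Qed.

Lemma block_cat u v k l e : (size v + k <= l)%N -> block (u ++ v) k e -> block u l e.
Proof.
move=> vk; rewrite /block /= size_cat => /andP[pe es]; apply/andP; split.
  exact: prefix_trans (prefix_prefix u v) pe.
by apply: leq_trans es _; rewrite -addnA leq_add2l.
Qed.

Lemma block_disjoint u u' k k' e : size u = size u' -> u != u' ->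
  block u k e -> ~~ block u' k' e.
Proof.
move=> su uu /andP[]; rewrite prefixE => /eqP ue _; apply/negP => /andP[].
by rewrite prefixE -su ue (negPf uu).
Qed.

Lemma block_below u v k l e : (k <= size v)%N -> block u k e -> ~~ block (u ++ v) l e.
Proof.
move=> kv /andP[_ es]; apply/negP => /andP[/size_prefix].
by rewrite size_cat leqNgt (leq_trans es)// leq_add2l.
Qed.

Lemma present_rep_dep u x k w w' : (size x <= k)%N ->
  (forall e, block u k e -> w e = w' e) ->
  present w u x = present w' u x /\ rep w u x = rep w' u x.
Proof.
elim: x u k => //= i x IH u [//|k] xk ww.
have E c : (w (u, c) == i) && present w (rcons u c) x =
    (w' (u, c) == i) && present w' (rcons u c) x.
  rewrite ww ?block_root//; congr (_ && _).
  by have [] := IH (rcons u c) k xk (fun e eb => ww e (block_rcons eb)).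
split; first exact: eq_existsb.
rewrite (eq_pick E); case: pickP => // c _; congr cons.
by have [] := IH (rcons u c) k xk (fun e eb => ww e (block_rcons eb)).
Qed.

End labelled_tree.

Section tree_law.
Variables (R : realType) (N M : nat) (p : 'I_N -> R) (i0 : 'I_N) (L : nat).
Hypotheses (M0 : (0 < M)%N) (p0 : forall i, 0 < p i) (p1 : \sum_i p i = 1).

Implicit Types (w : edge M -> 'I_N) (u v : seq 'I_M) (x : seq 'I_N).

Let D := ({bseq L of 'I_M} * 'I_M)%type.
Definition tree_emb (d : D) : edge M := (bseqval d.1, d.2).

Lemma tree_emb_inj : injective tree_emb.
Proof. by move=> [u c] [u' c'] [/val_inj -> ->]. Qed.

Lemma tree_embP (e : edge M) : (size e.1 <= L)%N -> exists d, tree_emb d = e.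
Proof. by case: e => u c uL; exists (Bseq uL, c). Qed.

(** Truncation at depth L makes the probability space finite; the deeper edges
    all get the label i0. *)
Definition tExp := @Exp R N p i0 (edge M) D tree_emb.

Let pge0 i : 0 <= p i. Proof. exact: ltW. Qed.
Let Mp i : 0 < M%:R * p i. Proof. by rewrite mulr_gt0// ltr0n. Qed.

Lemma tExp_cst c : tExp (fun=> c) = c. Proof. exact: Exp_cst. Qed.
Lemma tExp_sum (J : Type) (s : seq J) (F : J -> (edge M -> 'I_N) -> R) :
  tExp (fun w => \sum_(j <- s) F j w) = \sum_(j <- s) tExp (F j).
Proof. exact: Exp_sum. Qed.
Lemma tExp_le F G : (forall w, F w <= G w) -> tExp F <= tExp G.
Proof. exact: le_Exp. Qed.
Lemma tExp_ge0 F : (forall w, 0 <= F w) -> 0 <= tExp F.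
Proof. exact: Exp_ge0. Qed.
Lemma tExp_eq F G : (forall w, F w = G w) -> tExp F = tExp G.
Proof. exact: eq_Exp. Qed.
Lemma tExp_Z c F : tExp (fun w => c * F w) = c * tExp F.
Proof. exact: ExpZ. Qed.
Lemma tExp_indep S S' F G : depends_on S F -> depends_on S' G ->
  (forall e, S e -> ~~ S' e) -> tExp (fun w => F w * G w) = tExp F * tExp G.
Proof. by apply: Exp_indep => // ; exact: tree_emb_inj. Qed.

(** The second moment method: 1_{Y >= 1} >= 2 theta Y - theta^2 Y^2, with theta
    chosen to optimize the expectation of the right-hand side. *)
Lemma pairwise_union (A : 'I_M -> (edge M -> 'I_N) -> bool) :
  let y c := tExp (fun w => (A c w)%:R) in
  (forall c c', c != c' -> tExp (fun w => (A c w)%:R * (A c' w)%:R) = y c * y c') ->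
  (\sum_c y c) / (1 + \sum_c y c) <= tExp (fun w => [exists c, A c w]%:R).
Proof.
move=> y yy; set S := \sum_c y c.
have y0 c : 0 <= y c by apply: tExp_ge0 => w.
have S0 : 0 <= S by rewrite sumr_ge0.
pose Y w : R := \sum_c (A c w)%:R.
have EY : tExp Y = S by rewrite /Y tExp_sum.
have EY2 : tExp (fun w => Y w * Y w) <= S + S * S.
  have -> : tExp (fun w => Y w * Y w) =
      \sum_c \sum_c' tExp (fun w => (A c w)%:R * (A c' w)%:R).
    rewrite (@tExp_eq _ (fun w => \sum_c \sum_c' (A c w)%:R * (A c' w)%:R)) => [|w].
      by rewrite tExp_sum; apply: eq_bigr => c _; rewrite tExp_sum.
    by rewrite /Y mulr_suml; apply: eq_bigr => c _; rewrite mulr_sumr.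
  have -> : S + S * S = \sum_c (y c + y c * S) by rewrite big_split -mulr_suml.
  apply: ler_sum => c _ /=; rewrite (bigD1 c)//= mulr_sumr.
  rewrite lerD//.
    by apply: tExp_le => w; case: (A c w); rewrite ?mulr1 ?mulr0.
  rewrite [leRHS](bigD1 c)//= ler_wpDl ?mulr_ge0//.
  by apply: ler_sum => c' cc'; rewrite yy// eq_sym.
have S1 : 0 < 1 + S by lra.
pose t := (1 + S)^-1.
have t0 : 0 < t by rewrite invr_gt0.
apply: (@le_trans _ _ (tExp (fun w => 2 * t * Y w - t ^+ 2 * (Y w * Y w)))); last first.
  apply: tExp_le => w; case: (boolP [exists c, A c w]) => Aw.
    have : 0 <= (1 - t * Y w) ^+ 2 by rewrite sqr_ge0.
    by rewrite !expr2 /=; lra.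
  have -> : Y w = 0; last by rewrite !mulr0 subr0.
  rewrite /Y big1// => c _; move/existsPn : Aw => /(_ c) /negPf -> //.
rewrite [X in _ <= X](_ : _ = 2 * t * S - t ^+ 2 * tExp (fun w => Y w * Y w)); last first.
  by rewrite -EY -!tExp_Z; exact: ExpB.
have tS : t * (1 + S) = 1 by rewrite mulVf// gt_eqF.
have : t ^+ 2 * tExp (fun w => Y w * Y w) <= t ^+ 2 * (S + S * S).
  by rewrite ler_wpM2l// sqr_ge0.
have -> : t ^+ 2 * (S + S * S) = t * S * (t * (1 + S)) by ring.
by rewrite tS mulrC -/t; lra.
Qed.

Lemma tExp_edge u c i : (size u <= L)%N -> tExp (fun w => (w (u, c) == i)%:R) = p i.
Proof.
move=> uL; have [d dE] := @tree_embP (u, c) uL.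
by rewrite -dE; apply: Exp_edge => //; exact: tree_emb_inj.
Qed.

Definition Pr_present u x := tExp (fun w => (present w u x)%:R).

Let step u c i x w := (w (u, c) == i) && present w (rcons u c) x.

Let stepE u c i x w :
  (step u c i x w)%:R = (w (u, c) == i)%:R * (present w (rcons u c) x)%:R :> R.
Proof. by rewrite /step; case: eqP; rewrite ?mul1r ?mul0r. Qed.

Let Pr_step u c i x : (size u <= L)%N ->
  tExp (fun w => (step u c i x w)%:R) = p i * Pr_present (rcons u c) x.
Proof.
move=> uL; rewrite -(tExp_edge c i uL) (tExp_eq (stepE u c i x)).
apply: (@tExp_indep (pred1 (u, c)) (block (rcons u c) (size x))).
- by move=> w w' ww; rewrite ww/=.
- by move=> w w' ww; have [-> _] := present_rep_dep (leqnn _) ww.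
- move=> e /eqP -> /=; apply/negP => /andP[/size_prefix].
  by rewrite size_rcons ltnn.
Qed.

(** The events that x is read through the different children of u are independent,
    so that [pairwise_union] applies with S at least M p_i times the bound for
    the rest of the word. *)
Lemma Pr_present_ge u x : (size u + size x <= L.+1)%N ->
  (den M p x)^-1 <= Pr_present u x.
Proof.
elim: x u => [|i x IH] u uxL.
  by rewrite /Pr_present /= tExp_cst invr1.
rewrite /= addnS ltnS in uxL.
have uL : (size u <= L)%N by apply: leq_trans uxL; rewrite leq_addr.
pose s := M%:R * p i / den M p x.
have dx0 : 0 < den M p x by exact: den_gt0.
have s0 : 0 < s by rewrite divr_gt0.
pose S := \sum_c tExp (fun w => (step u c i x w)%:R).
have sS : s <= S.
  rewrite /s -mulrA -[M in M%:R]card_ord -sum1_card natr_sum mulr_suml.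
  apply: ler_sum => c _; rewrite mul1r Pr_step// ler_wpM2l//.
  by apply: IH; rewrite size_rcons addSn ltnS.
apply: (@le_trans _ _ (S / (1 + S))); last first.
  pose B c : pred (edge M) :=
    [pred e | (e == (u, c)) || block (rcons u c) (size x) e].
  have dB c : depends_on (B c) (fun w => (step u c i x w)%:R : R).
    move=> w w' ww; rewrite /step ww /B /= ?eqxx//.
    have [|-> _//] := @present_rep_dep _ _ (rcons u c) x _ w w' (leqnn _).
    by move=> e eb; rewrite ww /B //= eb orbT.
  apply: pairwise_union => c c' cc'; apply: (tExp_indep (dB c) (dB c')).
  have uuc a b k : ~~ block (rcons u a) k (u, b).
    by apply/negP => /andP[/size_prefix]; rewrite size_rcons ltnn.
  have rr : rcons u c != rcons u c' by rewrite eqseq_rcons eqxx.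
  move=> e /orP[/eqP ->|eb]; rewrite /B negb_or /= ?uuc ?xpair_eqE ?eqxx ?cc'//.
  apply/andP; split; first by apply: contraTneq eb => ->.
  by apply: block_disjoint eb => //; rewrite !size_rcons.
have -> : (1 + den M p x / (M%:R * p i))^-1 = s / (1 + s).
  rewrite /s; field; rewrite !gt_eqF ?ltr0n//=.
  by rewrite addr_gt0// mulr_gt0// ltr0n.
rewrite ler_pdivrMr; last by lra.
rewrite -mulrA [_^-1 * _]mulrC mulrA ler_pdivlMr; last by lra.
by lra.
Qed.

Lemma Pr_present_le1 u x : Pr_present u x <= 1.
Proof. by rewrite -[X in _ <= X]tExp_cst; apply: tExp_le => w; case: present. Qed.

Lemma Pr_present_le u x : (size u + size x <= L.+1)%N ->
  Pr_present u x <= \prod_(i <- x) (M%:R * p i).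
Proof.
elim: x u => [|i x IH] u uxL; first by rewrite big_nil Pr_present_le1.
rewrite /= addnS ltnS in uxL.
have uL : (size u <= L)%N by apply: leq_trans uxL; rewrite leq_addr.
apply: (@le_trans _ _ (\sum_c tExp (fun w => (step u c i x w)%:R))).
  rewrite -tExp_sum; apply: tExp_le => w /=; case: existsP => [[c cP]|_].
    by rewrite (bigD1 c)//= /step cP lerDl sumr_ge0.
  by rewrite sumr_ge0.
rewrite big_cons; set Q := \prod_(_ <- _) _.
rewrite -mulrA -[M in M%:R]card_ord -sum1_card natr_sum mulr_suml.
apply: ler_sum => c _; rewrite mul1r Pr_step// ler_wpM2l//.
by apply: IH; rewrite size_rcons addSn ltnS.
Qed.

End tree_law.

(** * The flow through a random tree of words *)

Section flow.
Variables (R : realType) (N M : nat).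
Implicit Types (w : edge M -> 'I_N) (u v : seq 'I_M) (x : seq 'I_N).
Variables (K : nat) (W : seq (seq 'I_N)) (lam : R).
Hypotheses (uW : uniq W) (sW : forall x, x \in W -> size x = K) (lam1 : 1 <= lam).

(** The maximal flow from the vertex u through j generations of the tree whose
    vertices are reached by reading words of W, when each vertex of generation l
    has capacity lam^(-l) times that of u. *)
Fixpoint flow (j : nat) (u : seq 'I_M) (w : edge M -> 'I_N) : R :=
  if j is j'.+1 then
    Num.min 1 (lam^-1 * \sum_(x <- W)
      if present w u x then flow j' (u ++ rep w u x) w else 0)
  else 1.

Let lam0 : 0 < lam. Proof. exact: lt_le_trans lam1. Qed.

Lemma flow_ge0 j u w : 0 <= flow j u w.
Proof.
elim: j u => //= j IH u; rewrite le_min ler01 mulr_ge0 ?invr_ge0 ?(ltW lam0)//.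
by rewrite sumr_ge0// => x _; case: ifP.
Qed.

Lemma flow_le1 j u w : flow j u w <= 1.
Proof. by case: j => //= j; rewrite ge_min lexx. Qed.

Lemma flow_decr j u w : flow j.+1 u w <= flow j u w.
Proof.
elim: j u => [|j IH] u; first exact: flow_le1.
rewrite [in leLHS]/= [in leRHS]/= le_min ge_min lexx/= ge_min; apply/orP; right.
rewrite ler_wpM2l ?invr_ge0 ?(ltW lam0)//; apply: ler_sum => x _.
by case: ifP => // _; exact: IH.
Qed.

Lemma flow_noninc u w : {homo flow ^~ u ^~ w : i j / (i <= j)%N >-> j <= i}.
Proof. by apply/nonincreasing_seqP => j; exact: flow_decr. Qed.

Lemma flow_dep j u : depends_on (block u (j * K)) (flow j u).
Proof.
elim: j u => [|j IH] u w w' ww //=; congr (Num.min _ (_ * _)).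
apply: eq_big_seq => x xW.
have xK : (size x <= j.+1 * K)%N by rewrite sW// mulSn leq_addr.
have [pE rE] := present_rep_dep xK ww.
rewrite -pE -rE; case: ifP => // px; apply: IH => e eb; apply: ww.
by apply: block_cat eb; rewrite size_rep// sW// mulSn.
Qed.

Section expectation.
Variables (p : 'I_N -> R) (i0 : 'I_N) (L : nat).
Hypotheses (M0 : (0 < M)%N) (p0 : forall i, 0 < p i) (p1 : \sum_i p i = 1).
Hypothesis rich : 2 * lam <= \sum_(x <- W) (den M p x)^-1.

Local Notation E := (tExp p i0 L).
(** The value for which the pairs of distinct words take away exactly half of the
    bound in [flow_expectation]. *)
Definition flow_bound : R := 2 * lam ^+ 2 / (size W)%:R ^+ 2.
Local Notation a := flow_bound.

Let size_W : 2 * lam <= (size W)%:R.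
Proof.
apply: le_trans rich _; rewrite -sum1_size natr_sum; apply: ler_sum => x _.
rewrite invf_le1; [exact: (den_ge1 M0 p0) | exact: (den_gt0 M0 p0)].
Qed.

Let W0 : 0 < (size W)%:R :> R.
Proof. by apply: lt_le_trans size_W; rewrite mulr_gt0. Qed.

Lemma flow_bound_gt0 : 0 < a.
Proof. by rewrite /a divr_gt0 ?mulr_gt0 ?exprn_gt0. Qed.

Lemma flow_bound_le1 : a <= 1.
Proof.
rewrite /a ler_pdivrMr ?exprn_gt0// mul1r.
apply: (@le_trans _ _ ((2 * lam) ^+ 2)); first by rewrite !expr2; nra.
by rewrite lerXn2r// nnegrE; [rewrite mulr_ge0// ltW | exact: ltW].
Qed.

(** This replaces the truncation by a polynomial, whose expectation can be
    computed. *)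
Let min_quad (y : R) : 0 <= y -> y - y ^+ 2 / 4 <= Num.min 1 y.
Proof.
move=> y0; rewrite le_min; apply/andP; split.
  by have := sqr_ge0 (y - 2); rewrite !expr2; lra.
by rewrite gerBl mulr_ge0// sqr_ge0.
Qed.

(** Rescale the flows out of the children of u to have expectation exactly
    [flow_bound]. Then lam^-1 times their sum, Y, has expectation at least twice
    this bound. In the expectation of Y^2 the pairs of distinct words contribute
    at most a multiple of the square of the bound, by independence, and each word
    with itself at most a multiple of the first moment. Hence Y - Y^2 / 4, a
    lower bound for the truncation of Y at 1, still has expectation at least
    [flow_bound]. *)
Lemma flow_expectation j u : (size u + j * K <= L.+1)%N -> a <= E (flow j u).
Proof.
elim: j u => [|j IH] u uL; first by rewrite tExp_cst// flow_bound_le1.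
have {}uL : (size u + K + j * K <= L.+1)%N by rewrite -addnA -mulSn.
have uKL : (size u + K <= L.+1)%N by apply: leq_trans uL; rewrite leq_addr.
have a0 := flow_bound_gt0.
pose th v := a / E (flow j (u ++ v)).
pose g v w := th v * flow j (u ++ v) w.
have aE v : size v = K -> a <= E (flow j (u ++ v)).
  by move=> vK; apply: IH; rewrite size_cat vK.
have th01 v : size v = K -> 0 <= th v <= 1.
  move=> vK; have aEv := aE v vK; have E0 := lt_le_trans a0 aEv.
  by rewrite divr_ge0 ?(ltW a0) ?(ltW E0)// ler_pdivrMr// mul1r.
have Eg v : size v = K -> E (g v) = a.
  move=> vK; rewrite tExp_Z /th divfK// gt_eqF//.
  exact: lt_le_trans (aE v vK).
have g0 v w : size v = K -> 0 <= g v w.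
  by move=> /th01/andP[t0 _]; rewrite mulr_ge0// flow_ge0.
have g1 v w : size v = K -> g v w <= 1.
  by move=> /th01/andP[t0 t1]; rewrite mulr_ile1 ?flow_ge0 ?flow_le1.
have gdep v : depends_on (block (u ++ v) (j * K)) (g v).
  by move=> w w' ww; rewrite /g (flow_dep ww).
pose Z x w := if present w u x then g (rep w u x) w else 0.
pose chosen x v w := present w u x && (rep w u x == v).
have ZE x w : x \in W -> Z x w = \sum_(v : K.-tuple 'I_M) (chosen x v w)%:R * g v w.
  move=> xW; rewrite /Z /chosen; case: ifP => px; last first.
    by rewrite big1// => v _; rewrite mul0r.
  have sr : size (rep w u x) == K by rewrite size_rep// sW.
  rewrite (bigD1 (Tuple sr))//= eqxx mul1r big1 ?addr0// => v.
  by rewrite -val_eqE/= eq_sym => /negPf ->; rewrite mul0r.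
have cdep x v : x \in W -> depends_on (block u K) (fun w => (chosen x v w)%:R : R).
  move=> xW w w' ww; rewrite /chosen.
  by have [|-> ->] := @present_rep_dep _ _ u x K w w' _ ww; rewrite ?sW.
have chosen1 x w : x \in W ->
    \sum_(v : K.-tuple 'I_M) (chosen x v w)%:R = (present w u x)%:R :> R.
  move=> xW; rewrite /chosen.
  case: (boolP (present w u x)) => px; last by rewrite big1.
  have sr : size (rep w u x) == K by rewrite size_rep// sW.
  rewrite (bigD1 (Tuple sr))//= eqxx big1 ?addr0// => v.
  by rewrite -val_eqE/= eq_sym => /negPf ->.
have Ec x : x \in W ->
    \sum_(v : K.-tuple 'I_M) E (fun w => (chosen x v w)%:R) = Pr_present p i0 L u x.
  by move=> xW; rewrite -tExp_sum; apply: tExp_eq => w; exact: chosen1.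
have EZ x : x \in W -> E (Z x) = Pr_present p i0 L u x * a.
  move=> xW; rewrite (tExp_eq p i0 L (fun w => ZE x w xW)) tExp_sum -Ec// mulr_suml.
  apply: eq_bigr => v _; rewrite -[in RHS](Eg v) ?size_tuple//.
  apply: (tExp_indep i0 L p1 (cdep x v xW) (gdep v)) => e.
  by apply: block_below; rewrite size_tuple.
have Z01 x w : x \in W -> 0 <= Z x w <= 1.
  move=> xW; rewrite /Z; case: ifP => px; last by rewrite lexx ler01.
  by rewrite g0 ?g1// size_rep// sW.
(* Distinct words are read along distinct paths, below which the flows are
   independent of each other and of the choice of the paths. *)
have EZZ x x' : x \in W -> x' \in W -> x != x' ->
    E (fun w => Z x w * Z x' w) <= a ^+ 2.
  move=> xW x'W xx.
  pose cc (v v' : K.-tuple 'I_M) w := (chosen x v w)%:R * (chosen x' v' w)%:R : R.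
  have ccE (v : K.-tuple 'I_M) w : cc v v w = 0.
    rewrite /cc /chosen; case: andP => [[px /eqP rv]|]; last by rewrite mul0r.
    case: andP => [[px' /eqP rv']|]; last by rewrite mulr0.
    by move: xx; rewrite -(read_rep px) -(read_rep px') rv rv' eqxx.
  rewrite (@tExp_eq _ _ _ p i0 L _ (fun w => \sum_(v : K.-tuple 'I_M)
    \sum_(v' : K.-tuple 'I_M) cc v v' w * (g v w * g v' w))).
    rewrite tExp_sum.
    apply: (@le_trans _ _ (\sum_(v : K.-tuple 'I_M) \sum_(v' : K.-tuple 'I_M)
      E (cc v v') * a ^+ 2)).
      apply: ler_sum => v _; rewrite tExp_sum; apply: ler_sum => v' _.
      have [<-|vv] := eqVneq v v'.
        rewrite (@tExp_eq _ _ _ p i0 L _ (fun=> 0)); last by move=> w; rewrite ccE mul0r.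
        rewrite tExp_cst// mulr_ge0 ?sqr_ge0//.
        by apply: tExp_ge0 => // w; rewrite ccE.
      rewrite le_eqVlt; apply/orP; left; apply/eqP.
      have uvv : size (u ++ v) = size (u ++ v') by rewrite !size_cat !size_tuple.
      have nuv : u ++ v != u ++ v' by rewrite eqseq_cat// eqxx.
      rewrite expr2 -{1}(Eg v) ?size_tuple// -{1}(Eg v') ?size_tuple//.
      have disj e : block (u ++ v) (j * K) e -> ~~ block (u ++ v') (j * K) e.
        exact: block_disjoint.
      rewrite -(tExp_indep i0 L p1 (gdep v) (gdep v') disj).
      pose S : pred (edge M) :=
        [pred e | block (u ++ v) (j * K) e || block (u ++ v') (j * K) e].
      apply: (@tExp_indep _ _ _ p i0 L p1 (block u K) S).
      - by move=> w w' ww; rewrite /cc (cdep x v xW _ _ ww) (cdep x' v' x'W _ _ ww).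
      - move=> w w' ww; congr (_ * _); first by apply: gdep => e eb; rewrite ww// /S /= eb.
        by apply: gdep => e eb; rewrite ww// /S /= eb orbT.
      - by move=> e eb; rewrite /S negb_or; apply/andP; split;
          apply: block_below eb; rewrite size_tuple.
    under eq_bigr do rewrite -mulr_suml.
    rewrite -mulr_suml -[leRHS]mul1r ler_wpM2r ?sqr_ge0//.
    under eq_bigr do rewrite -tExp_sum.
    rewrite -tExp_sum -[leRHS](@tExp_cst R N M p i0 L p1 1); apply: tExp_le => // w.
    rewrite /cc; under eq_bigr do rewrite -mulr_sumr.
    rewrite -mulr_suml !chosen1//.
    by case: present; case: present; rewrite ?mulr0 ?mulr1.
  move=> w; rewrite !ZE// mulr_suml; apply: eq_bigr => v _; rewrite mulr_sumr.
  by apply: eq_bigr => v' _; rewrite /cc mulrACA.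
pose m := \sum_(x <- W) Pr_present p i0 L u x.
have m2 : 2 * lam <= m.
  apply: le_trans rich _; rewrite /m !big_seq; apply: ler_sum => x xW.
  by apply: Pr_present_ge => //; rewrite sW.
pose Y w := lam^-1 * \sum_(x <- W) Z x w.
have EY : E Y = lam^-1 * (m * a).
  rewrite tExp_Z tExp_sum; congr (_ * _); rewrite /m mulr_suml.
  by apply: eq_big_seq => x xW; rewrite EZ.
have EY2 : E (fun w => Y w ^+ 2) <= lam^-1 ^+ 2 * (m * a + (size W)%:R ^+ 2 * a ^+ 2).
  rewrite (@tExp_eq _ _ _ p i0 L _
    (fun w => lam^-1 ^+ 2 * \sum_(x <- W) \sum_(x' <- W) Z x w * Z x' w)); last first.
    move=> w; rewrite /Y exprMn; congr (_ * _); rewrite expr2 mulr_suml.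
    by apply: eq_bigr => x _; rewrite mulr_sumr.
  rewrite tExp_Z ler_wpM2l ?sqr_ge0// tExp_sum.
  have -> : m * a + (size W)%:R ^+ 2 * a ^+ 2 =
      \sum_(x <- W) (Pr_present p i0 L u x * a + (size W)%:R * a ^+ 2).
    rewrite big_split/= -mulr_suml -/m big_const_seq count_predT iter_addr_0.
    by rewrite -[in RHS](mulr_natl (_ * _)) [_%:R ^+ 2]expr2 mulrA.
  rewrite !big_seq; apply: ler_sum => x xW; rewrite tExp_sum.
  apply: (@le_trans _ _ (\sum_(x' <- W) ((x' == x)%:R * (Pr_present p i0 L u x * a) + a ^+ 2))).
    rewrite !big_seq; apply: ler_sum => x' x'W.
    have [->|xx] := eqVneq x' x.
      rewrite mul1r ler_wpDr ?sqr_ge0// -EZ//; apply: tExp_le => // w.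
      by have /andP[z0 z1] := Z01 x w xW; rewrite -[leRHS]mulr1 ler_wpM2l.
    by rewrite mul0r add0r; apply: EZZ => //; rewrite eq_sym.
  rewrite big_split/= -mulr_suml (bigD1_seq x)//= eqxx big1 ?addr0 ?mul1r.
    by rewrite big_const_seq count_predT iter_addr_0 mulr_natl.
  by move=> x' /negPf ->.
apply: (@le_trans _ _ (E (fun w => Y w - Y w ^+ 2 / 4))); last first.
  apply: tExp_le => // w; have Y0 : 0 <= Y w.
    rewrite mulr_ge0 ?invr_ge0 ?(ltW lam0)// big_seq sumr_ge0// => x xW.
    by have /andP[] := Z01 x w xW.
  apply: le_trans (min_quad Y0) _ => /=.
  rewrite le_min ge_min lexx/= ge_min; apply/orP; right.
  rewrite ler_wpM2l ?invr_ge0 ?(ltW lam0)// !big_seq; apply: ler_sum => x xW.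
  rewrite /Z; case: ifP => // px; rewrite /g -[leRHS]mul1r ler_wpM2r ?flow_ge0//.
  by have /andP[] : 0 <= th (rep w u x) <= 1 by apply: th01; rewrite size_rep// sW.
have -> : E (fun w => Y w - Y w ^+ 2 / 4) = E Y - 4^-1 * E (fun w => Y w ^+ 2).
  by rewrite -tExp_Z -[RHS]ExpB; apply: tExp_eq => w; rewrite [_ / 4]mulrC.
have aW : (size W)%:R ^+ 2 * a ^+ 2 = 2 * lam ^+ 2 * a.
  by rewrite /a; field; rewrite gt_eqF.
rewrite aW in EY2; rewrite EY.
have lamV : lam^-1 * lam = 1 by rewrite mulVf// gt_eqF.
have i0' : 0 < lam^-1 by rewrite invr_gt0.
have i1 : lam^-1 <= 1 by rewrite invf_le1.
have E2 : lam^-1 ^+ 2 * (m * a + 2 * lam ^+ 2 * a) = lam^-1 ^+ 2 * m * a + 2 * a.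
  by field; rewrite gt_eqF.
rewrite E2 in EY2.
pose q := lam^-1 * m; have q2 : 2 <= q by rewrite /q mulrC ler_pdivlMr.
have h1 : lam^-1 ^+ 2 * m * a <= q * a.
  rewrite ler_wpM2r ?(ltW a0)// /q expr2 -mulrA -[leRHS]mul1r ler_wpM2r//.
  by apply: le_trans q2.
have h2 : 2 * a <= q * a by rewrite ler_wpM2r ?(ltW a0).
rewrite mulrA -/q; lra.
Qed.

End expectation.
End flow.

(** * Almost sure properties of the tree *)

Section almost_sure.
Variables (R : realType) (N M : nat) (p : 'I_N -> R) (i0 : 'I_N).
Hypotheses (M2 : (2 <= M)%N) (p0 : forall i, 0 < p i) (p1 : \sum_i p i = 1).
Variables (disp : measure_display) (T : measurableType disp) (P : probability T R).
Variables (omega : edge M -> T -> 'I_N).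
Hypothesis homega : random_labelling P p omega.
Implicit Types (w : edge M -> 'I_N) (u v : seq 'I_M) (x : seq 'I_N).

Let M0 : (0 < M)%N. Proof. exact: leq_trans M2. Qed.

Lemma law_of_tree (A : (edge M -> 'I_N) -> bool) n L : (n <= L.+1)%N ->
  depends_on (block [::] n) A ->
  measurable [set t | A (omega ^~ t)] /\
  P [set t | A (omega ^~ t)] = (tExp p i0 L (fun w => (A w)%:R))%:E.
Proof.
move=> nL dA; case: homega => mom iom lom.
apply: law_of_labels => //; first exact: tree_emb_inj.
move=> w w' ww; apply: dA => e /andP[_ /= en]; apply: ww => /=.
have [d dE] := @tree_embP M L e (leq_trans en nL).
by apply/existsP; exists d; rewrite dE.
Qed.

Lemma prob_bigcup_le (F : nat -> set T) (c : \bar R) :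
  (forall n, measurable (F n)) -> (forall n, F n `<=` F n.+1) ->
  (forall n, (P (F n) <= c)%E) -> (P (\bigcup_n F n) <= c)%E.
Proof.
move=> mF ndF Fc; have mU : measurable (\bigcup_n F n) by exact: bigcupT_measurable.
have ndF' : {homo F : n m / (n <= m)%N >-> (n <= m)%O}.
  by apply/nondecreasing_seqP => n; apply/subsetPset.
have cv := nondecreasing_cvg_mu (mu := P) mF mU ndF'.
rewrite -(cvg_lim _ cv)//; apply: lime_le.
  by apply: cvgP cv.
by apply: nearW => n; exact: Fc.
Qed.

Section flow_survival.
Variables (K : nat) (W : seq (seq 'I_N)) (lam : R).
Hypotheses (uW : uniq W) (sW : forall x, x \in W -> size x = K) (lam1 : 1 <= lam).
Hypothesis rich : 2 * lam <= \sum_(x <- W) (den M p x)^-1.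
Local Notation flow := (flow W lam).
Local Notation c := (flow_bound W lam / 2).

Let c_gt0 : 0 < c.
Proof. by rewrite divr_gt0// (flow_bound_gt0 lam1 M0 p0 rich). Qed.

Let c_lt1 : c < 1.
Proof.
rewrite ltr_pdivrMr// mul1r.
by apply: le_lt_trans (flow_bound_le1 lam1 M0 p0 rich) _; rewrite ltr1n.
Qed.

Let c0 : 'I_M := Ordinal M0.
Let c1 : 'I_M := Ordinal M2.

(** Two children of each vertex provide 2^l independent attempts to find a flow
    of at least c. *)
Fixpoint fail (j l : nat) u w : bool :=
  if l is l'.+1 then fail j l' (rcons u c0) w && fail j l' (rcons u c1) w
  else flow j u w < c.

Let fail_dep j l u : depends_on (block u (l + j * K)) (fail j l u).
Proof.
elim: l u => [|l IH] u w w' ww /=; first by rewrite (flow_dep lam sW ww).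
by congr (_ && _); apply: IH => e eb; apply: ww; rewrite addSn; exact: block_rcons eb.
Qed.

Let fail_incr j j' l u w : (j <= j')%N -> fail j l u w -> fail j' l u w.
Proof.
move=> jj; elim: l u => [|l IH] u /=.
  by apply: le_lt_trans; exact: flow_noninc.
by case/andP => /IH -> /IH ->.
Qed.

Let fail_prob L j l u : (size u + l + j * K <= L.+1)%N ->
  tExp p i0 L (fun w => (fail j l u w)%:R) <= (1 - c) ^+ l.+1.
Proof.
have c1_ge0 : 0 <= 1 - c by rewrite subr_ge0 ltW.
elim: l u => [|l IH] u uL.
  rewrite expr1.
  have := @flow_expectation _ _ _ _ _ _ uW sW lam1 _ i0 L M0 p0 p1 rich j u.
  rewrite -[size u]addn0 => /(_ uL) aE.
  have : flow_bound W lam <= tExp p i0 L (fun w => (1 + c) - (fail j 0 u w)%:R).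
    apply: le_trans aE _; apply: tExp_le => // w /=.
    have := flow_le1 W lam j u w; have := c_gt0.
    by case: (ltP (flow j u w) c) => /=; lra.
  have -> : tExp p i0 L (fun w => (1 + c) - (fail j 0 u w)%:R) =
      (1 + c) - tExp p i0 L (fun w => (fail j 0 u w)%:R).
    by rewrite -[in RHS](@tExp_cst R N M p i0 L p1 (1 + c)); exact: ExpB.
  lra.
have uc b : (size (rcons u b) + l + j * K <= L.+1)%N.
  by rewrite size_rcons addSnnS.
rewrite (@tExp_eq _ _ _ p i0 L _ (fun w =>
  (fail j l (rcons u c0) w)%:R * (fail j l (rcons u c1) w)%:R)); last first.
  by move=> w /=; case: fail; rewrite ?mul1r ?mul0r.
have dep b : depends_on (block (rcons u b) (l + j * K))
    (fun w => (fail j l (rcons u b) w)%:R : R).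
  by move=> w w' ww; rewrite (fail_dep ww).
rewrite (tExp_indep i0 L p1 (dep c0) (dep c1)); last first.
  by move=> e; apply: block_disjoint; rewrite ?size_rcons// eqseq_rcons eqxx.
apply: (@le_trans _ _ ((1 - c) ^+ l.+1 * (1 - c) ^+ l.+1)).
  by apply: ler_pM; rewrite ?IH//; apply: tExp_ge0.
rewrite -exprD; apply: ler_wiXn2l; rewrite ?leq_addr//.
  by rewrite gerBl ltW.
by rewrite addSn addnS ltnS ltnS leq_addr.
Qed.

Let descend l u w : (forall j, ~~ fail j l u w) ->
  exists v, forall j, c <= flow j v w.
Proof.
elim: l u => [|l IH] u nf; first by exists u => j; rewrite leNgt; exact: nf.
have [n0|] := pselect (forall j, ~~ fail j l (rcons u c0) w); first exact: IH n0.
move=> /existsNP[j0 /negP/negPn f0].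
apply: (IH (rcons u c1)) => j1; apply/negP => f1.
move: (nf (maxn j0 j1)) => /=; rewrite (fail_incr _ f0) ?leq_maxl//.
by rewrite (fail_incr _ f1) ?leq_maxr.
Qed.

(** The subtrees hanging off a large generation are independent, so that almost
    surely the flow survives from at least one of its vertices. *)
Lemma flow_survives :
  {ae P, forall t, exists u, forall j, c <= flow j u (omega ^~ t)}.
Proof.
pose F l j := [set t | fail j l [::] (omega ^~ t)].
have FE l j : measurable (F l j) /\ (P (F l j) <= ((1 - c) ^+ l.+1)%:E)%E.
  have [mF ->] := @law_of_tree (fail j l [::]) (l + j * K) (l + j * K) (leqnSn _)
    (@fail_dep j l [::]).
  by split => //; rewrite lee_fin fail_prob// add0n.
have mU l : measurable (\bigcup_j F l j).
  by apply: bigcupT_measurable => j; have [] := FE l j.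
exists (\bigcap_l \bigcup_j F l j); split.
- exact: bigcapT_measurable.
- apply/eqP; rewrite eq_le measure_ge0 andbT; apply/lee_addgt0Pr => e e0.
  rewrite add0e.
  have : (1 - c) ^+ l @[l --> \oo] --> (0 : R).
    by apply: cvg_expr; rewrite ger0_norm; [rewrite gtrBl | rewrite subr_ge0 ltW].
  move=> /cvgr0Pnorm_le /(_ e e0) [l _ /(_ l.+1)] /= /(_ (leqnSn _)) le.
  apply: (@le_trans _ _ (P (\bigcup_j F l j))).
    by apply: le_measure; rewrite ?inE//; [exact: bigcapT_measurable | move=> t; apply].
  apply: (@le_trans _ _ ((1 - c) ^+ l.+1)%:E).
    apply: prob_bigcup_le => j; try by have [] := FE l j.
    by move=> t; apply: fail_incr.
  by rewrite lee_fin; apply: le_trans le; exact: ler_norm.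
- move=> t /= ht l _; apply: contrapT => nF; apply: ht.
  apply: (@descend l [::]) => j; apply/negP => fj; apply: nF.
  by exists j.
Qed.

End flow_survival.
End almost_sure.

(** * The mass of the present words *)
Section first_moment.
Variables (R : realType) (N M : nat) (r p : 'I_N -> R) (i0 : 'I_N).
Hypotheses (M2 : (2 <= M)%N) (p0 : forall i, 0 < p i) (p1 : \sum_i p i = 1).
Hypothesis r01 : forall i, 0 < r i < 1.
Variable v : R.
Hypothesis vmax : forall y, (forall i, 0 <= y i) -> hfun r y = 1 -> rate M p y <= v.
Implicit Types (w : edge M -> 'I_N) (u : seq 'I_M) (x : seq 'I_N).

Definition ratio x : R := \prod_(i <- x) r i.

Let r0 i : 0 < r i. Proof. by have /andP[] := r01 i. Qed.
Let M0 : (0 < M)%N. Proof. exact: leq_trans M2. Qed.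

Lemma ratio_gt0 x : 0 < ratio x. Proof. exact: prodr_gt0. Qed.

Let cnt x : 'I_N -> nat := fun i => count_mem i x.

Lemma ln_prod_word (g : 'I_N -> R) x : (forall i, 0 < g i) ->
  \prod_(i <- x) g i = expR (\sum_i type_vec R (cnt x) i * ln (g i)).
Proof.
move=> g0; rewrite prod_word expR_sum; apply: eq_bigr => i _.
by rewrite expRM_natl lnK// posrE.
Qed.

Lemma ratio_powE x s : ratio x `^ s = expR (- s * hfun r (type_vec R (cnt x))).
Proof.
rewrite /ratio ln_prod_word// -expRM; congr expR.
by rewrite /hfun mulrNN mulrC.
Qed.

(** A word is present with probability at most exp(min(0, phi)), so weighting it
    with ratio^v bounds its contribution by exp(- psi): the words of each type
    contribute at most one, and there are polynomially many types. *)
Lemma weighted_presence L k : (k <= L.+1)%N ->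
  \sum_(x <- allwords N k) Pr_present p i0 L ([::] : seq 'I_M) x * ratio x `^ v <=
  k.+1%:R ^+ N.
Proof.
move=> kL; pose tau x : {ffun 'I_N -> 'I_k.+1} := [ffun i => inord (cnt x i)].
apply: (@le_trans _ _ (\sum_(x <- allwords N k) expR (- psi (type_vec R (cnt x))))).
  rewrite !big_seq; apply: ler_sum => x; rewrite mem_allwords => /eqP xk.
  have pm : Pr_present p i0 L ([::] : seq 'I_M) x <=
      expR (Num.min 0 (phi M p (type_vec R (cnt x)))).
    rewrite /Num.min; case: ifP => _; first by rewrite expR0 Pr_present_le1.
    have := @Pr_present_le R N M p i0 L p0 p1 [::] x.
    rewrite add0n xk => /(_ kL); rewrite ln_prod_word// => i.
    by rewrite mulr_gt0// ltr0n.
  apply: le_trans (_ : expR (Num.min 0 (phi M p (type_vec R (cnt x)))) * ratio x `^ v <= _).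
    by rewrite ler_wpM2r// powR_ge0.
  rewrite ratio_powE -expRD ler_expR.
  have := rate_le r01 vmax (type_vec_ge0 R (cnt x)); rewrite /rate; lra.
rewrite (partition_big tau predT)//=.
have -> : k.+1%:R ^+ N = \sum_(t : {ffun 'I_N -> 'I_k.+1}) (1 : R).
  by rewrite sumr_const card_ffun !card_ord natrX.
apply: ler_sum => t _.
pose n i : nat := t i.
have tn x : x \in allwords N k -> tau x == t -> of_type n x.
  rewrite mem_allwords => /eqP xk /eqP tx; apply/of_typeP => i.
  by rewrite /n -tx ffunE inordK// ltnS -xk count_size.
apply: (@le_trans _ _ (\sum_(x <- allwords N k | tau x == t) expR (- psi (type_vec R n)))).
  rewrite big_seq_cond [leRHS]big_seq_cond; apply: ler_sum => x /andP[xk tx].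
  suff -> : cnt x = n by [].
  by apply/funext => i; apply/of_typeP; exact: tn.
rewrite -big_filter big_const_seq count_predT iter_addr_0 -mulr_natl.
rewrite expRN ler_pdivrMr ?expR_gt0// mul1r.
apply: le_trans (size_type_class_le R n); rewrite ler_nat.
apply: uniq_leq_size; first by rewrite filter_uniq// allwords_uniq.
by move=> x; rewrite mem_filter mem_type_class => /andP[tx xk]; exact: tn.
Qed.

Definition mass (s : R) (n : nat) w : R :=
  \sum_(k < n) \sum_(x <- allwords N k | present w [::] x) ratio x `^ s.

Let th := \big[Num.min/1]_i - ln (r i).

Let th_gt0 : 0 < th.
Proof.
rewrite /th; elim/big_ind : _ => // [x y x0 y0|i _]; first by rewrite lt_min x0.
by rewrite oppr_gt0 ln_lt0.
Qed.

Let ratio_le x : ratio x <= expR (- th * (size x)%:R).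
Proof.
elim: x => [|i x IH]; first by rewrite /ratio big_nil mulr0 expR0.
rewrite /ratio big_cons -/(ratio x) /= -natr1 mulrDr mulr1 addrC expRD.
apply: ler_pM => //; [exact: ltW | exact/ltW/ratio_gt0 |].
rewrite -[leLHS]lnK ?posrE// ler_expR lerNr.
by rewrite /th; apply: bigmin_le_cond.
Qed.

Lemma geometric_bound (q : R) n : 0 <= q < 1 -> \sum_(k < n) q ^+ k <= (1 - q)^-1.
Proof.
move=> /andP[q0 q1]; have d0 : 0 < 1 - q by rewrite subr_gt0.
rewrite -[leRHS]mul1r ler_pdivlMr//.
suff -> : (\sum_(k < n) q ^+ k) * (1 - q) = 1 - q ^+ n by rewrite gerBl exprn_ge0.
elim: n => [|n IH]; first by rewrite big_ord0 expr0 mul0r subrr.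
by rewrite big_ord_recr/= mulrDl IH exprS; ring.
Qed.

(** By [weighted_presence], the words of length k contribute at most (k + 1)^N
    times the largest value of ratio^(s - v), which decays exponentially in k. *)
Lemma expected_mass s : v < s ->
  exists C : R, forall n L, (n <= L.+1)%N -> tExp p i0 L (mass s n) <= C.
Proof.
move=> vs; pose b := th * (s - v) / 2.
have b0 : 0 < b by rewrite divr_gt0// mulr_gt0// subr_gt0.
pose q := expR (- b).
have q01 : 0 <= q < 1 by rewrite expR_ge0/= -expR0 ltr_expR oppr_lt0.
pose C := N`!%:R / b ^+ N * expR b.
have C0 : 0 <= C.
  by rewrite !mulr_ge0 ?expR_ge0 ?invr_ge0 ?exprn_ge0// ltW.
exists (C * (1 - q)^-1) => n L nL.
apply: (@le_trans _ _ (\sum_(k < n) C * q ^+ k)); last first.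
  by rewrite -mulr_sumr ler_wpM2l// geometric_bound.
rewrite tExp_sum; apply: ler_sum => k _.
have kL : (k <= L.+1)%N by apply: leq_trans nL; exact: ltnW.
rewrite (@tExp_eq _ _ _ p i0 L _ (fun w => \sum_(x <- allwords N k)
    ratio x `^ s * (present w [::] x)%:R)); last first.
  move=> w; rewrite big_mkcond; apply: eq_bigr => x _.
  by case: present; rewrite ?mulr1 ?mulr0.
rewrite tExp_sum; under eq_bigr do rewrite tExp_Z -/(Pr_present p i0 L _ _).
apply: (@le_trans _ _ (expR (- (2 * b) * k%:R) * k.+1%:R ^+ N)).
  apply: le_trans (_ : expR (- (2 * b) * k%:R) * \sum_(x <- allwords N k)
    Pr_present p i0 L ([::] : seq 'I_M) x * ratio x `^ v <= _); last first.
    by rewrite ler_wpM2l ?expR_ge0// weighted_presence.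
  rewrite mulr_sumr !big_seq; apply: ler_sum => x; rewrite mem_allwords => /eqP xk.
  rewrite mulrC mulrCA ler_wpM2l//; first exact: tExp_ge0.
  rewrite -{1}(subrK v s) powRD; last by apply/implyP => _; rewrite gt_eqF// ratio_gt0.
  rewrite ler_wpM2r ?powR_ge0//.
  apply: (@le_trans _ _ (expR (- th * k%:R) `^ (s - v))).
    apply: ge0_ler_powR; rewrite ?nnegrE ?expR_ge0//.
    - by rewrite subr_ge0 ltW.
    - exact/ltW/ratio_gt0.
    - by rewrite -xk; exact: ratio_le.
  by rewrite -expRM ler_expR /b; lra.
have k1 : k.+1%:R ^+ N <= N`!%:R / b ^+ N * expR (b * k.+1%:R) :> R.
  have y0 : 0 <= b * k.+1%:R by rewrite mulr_ge0// ltW.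
  have : (b * k.+1%:R) ^+ N / N`!%:R <= expR (b * k.+1%:R).
    case: (N) => [|N']; first by rewrite expr0 fact0 divr1 -[leLHS]expR0 ler_expR.
    by have := expR_ge1Dxn N' y0; lra.
  rewrite exprMn ler_pdivrMr ?ltr0n ?fact_gt0// => h.
  by rewrite mulrAC ler_pdivlMr ?exprn_gt0// mulrC [leRHS]mulrC.
apply: (@le_trans _ _ (expR (- (2 * b) * k%:R) * (N`!%:R / b ^+ N * expR (b * k.+1%:R)))).
  by rewrite ler_wpM2l ?expR_ge0.
rewrite /C /q -expRM_natl mulrCA -mulrA -!expRD ler_wpM2l//.
  by rewrite mulr_ge0// invr_ge0 exprn_ge0// ltW.
by rewrite ler_expR -natr1; lra.
Qed.

Let mass_ge0 s n w : 0 <= mass s n w.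
Proof. by rewrite sumr_ge0// => k _; rewrite sumr_ge0// => x _; rewrite powR_ge0. Qed.

Let mass_incr s n w : mass s n w <= mass s n.+1 w.
Proof.
rewrite /mass big_ord_recr lerDl sumr_ge0// => x _; exact: powR_ge0.
Qed.

Let mass_dep s n : depends_on (block [::] n) (mass s n).
Proof.
move=> w w' ww; apply: eq_bigr => k _.
rewrite big_seq_cond [RHS]big_seq_cond; apply: eq_bigl => x.
case: (boolP (x \in _)) => //=; rewrite mem_allwords => /eqP xk.
have [|-> _//] := @present_rep_dep _ _ [::] x n w w' _ ww.
by rewrite xk ltnW.
Qed.

Variables (disp : measure_display) (T : measurableType disp) (P : probability T R).
Variables (omega : edge M -> T -> 'I_N).
Hypothesis homega : random_labelling P p omega.

(** Markov's inequality, uniformly in the length of the words. *)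
Lemma mass_bounded s : v < s ->
  {ae P, forall t, exists B : R, forall n, mass s n (omega ^~ t) <= B}.
Proof.
move=> vs; have [C0 C0E] := expected_mass vs; pose C := Num.max 1 C0.
have CE n L : (n <= L.+1)%N -> tExp p i0 L (mass s n) <= C.
  by move=> nL; apply: le_trans (C0E n L nL) _; rewrite le_max lexx orbT.
have C1 : 0 < C by rewrite lt_max ltr01.
pose F m n := [set t | m.+1%:R < mass s n (omega ^~ t)].
have FE m n : measurable (F m n) /\ (P (F m n) <= (C / m.+1%:R)%:E)%E.
  have [] := @law_of_tree R N M p i0 _ _ P omega homega
    (fun w => m.+1%:R < mass s n w) n n (leqnSn _).
    by move=> w w' ww; rewrite (mass_dep s ww).
  move=> mF PF; split => //; rewrite [X in (X <= _)%E]PF lee_fin.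
  rewrite ler_pdivlMr// mulrC -tExp_Z; apply: le_trans (CE n n (leqnSn _)).
  apply: tExp_le => // w; case: ltP => mw; last by rewrite mulr0; exact: mass_ge0.
  by rewrite mulr1 ltW.
have mU m : measurable (\bigcup_n F m n).
  by apply: bigcupT_measurable => n; have [] := FE m n.
exists (\bigcap_m \bigcup_n F m n); split.
- exact: bigcapT_measurable.
- apply/eqP; rewrite eq_le measure_ge0 andbT; apply/lee_addgt0Pr => e e0.
  rewrite add0e; have [m [_ mlt]] := natr_gt_bound (C / e).
  apply: (@le_trans _ _ (P (\bigcup_n F m n))).
    by apply: le_measure; rewrite ?inE//; [exact: bigcapT_measurable | move=> t; apply].
  apply: (@le_trans _ _ (C / m.+1%:R)%:E).
    apply: prob_bigcup_le => n; try by have [] := FE m n.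
    move=> t; rewrite /F /= => mlt_n; apply: lt_le_trans mlt_n _; exact: mass_incr.
  rewrite lee_fin ler_pdivrMr// -ler_pdivrMl// mulrC.
  by apply: le_trans (ltW mlt) _; rewrite ler_nat.
- move=> t /= ht m _; apply: contrapT => nF; apply: ht.
  exists m.+1%:R => n; rewrite leNgt; apply/negP => mn; apply: nF.
  by exists n.
Qed.

End first_moment.

(** * Euclidean geometry and similarities *)

Section euclid.
Variables (R : realType) (d : nat).
Implicit Types x y z : 'rV[R]_d.

Definition dot x y : R := \sum_i x ord0 i * y ord0 i.

Lemma dotC x y : dot x y = dot y x.
Proof. by apply: eq_bigr => i _; rewrite mulrC. Qed.

Lemma dotDl x y z : dot (x + y) z = dot x z + dot y z.
Proof. by rewrite -big_split; apply: eq_bigr => i _; rewrite mxE mulrDl. Qed.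

Lemma dotZl a x y : dot (a *: x) y = a * dot x y.
Proof. by rewrite mulr_sumr; apply: eq_bigr => i _; rewrite mxE mulrA. Qed.

Lemma dotNl x y : dot (- x) y = - dot x y.
Proof. by rewrite -scaleN1r dotZl mulN1r. Qed.

Lemma dot_ge0 x : 0 <= dot x x.
Proof. by apply: sumr_ge0 => i _; rewrite -expr2 sqr_ge0. Qed.

Lemma enormE x : enorm x = Num.sqrt (dot x x).
Proof. by rewrite /enorm; congr Num.sqrt; apply: eq_bigr => i _; rewrite expr2. Qed.

Lemma enorm_ge0 x : 0 <= enorm x. Proof. exact: sqrtr_ge0. Qed.

Lemma enorm_sqr x : enorm x ^+ 2 = dot x x.
Proof. by rewrite enormE sqr_sqrtr// dot_ge0. Qed.

Lemma dotBB x y : dot (x - y) (x - y) = dot x x - 2 * dot x y + dot y y.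
Proof.
rewrite dotDl dotNl dotC [dot y _]dotC !dotDl !dotNl [dot y x]dotC; ring.
Qed.

Lemma cauchy_schwarz x y : dot x y ^+ 2 <= dot x x * dot y y.
Proof.
have := dot_ge0 y; rewrite le_eqVlt => /predU1P[y0|y0].
  suff -> : dot x y = 0 by rewrite expr2 -y0 !mulr0.
  rewrite /dot big1// => i _; suff -> : y ord0 i = 0 by rewrite mulr0.
  apply/eqP; rewrite -sqrf_eq0 expr2 eq_le; apply/andP; split; last exact: sqr_ge0.
  rewrite [leRHS]y0 /dot (bigD1 i)//= lerDl sumr_ge0// => j _.
  by rewrite -expr2 sqr_ge0.
have := dot_ge0 (dot y y *: x - dot x y *: y).
rewrite dotBB !dotZl ![dot _ (_ *: _)]dotC !dotZl [dot y x]dotC => h.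
have {h} : 0 <= dot y y * (dot x x * dot y y - dot x y ^+ 2).
  by apply: le_trans h _; rewrite le_eqVlt; apply/orP; left; apply/eqP; ring.
by rewrite pmulr_rge0// subr_ge0.
Qed.

Lemma enormD x y : enorm (x + y) <= enorm x + enorm y.
Proof.
rewrite -(@ler_pXn2r _ 2)// ?nnegrE ?addr_ge0 ?enorm_ge0//.
rewrite enorm_sqr sqrrD !enorm_sqr dotDl dotC [dot y _]dotC !dotDl [dot y x]dotC.
have : dot x y <= enorm x * enorm y.
  apply: le_trans (ler_norm _) _.
  rewrite -(@ler_pXn2r _ 2)// ?nnegrE ?mulr_ge0 ?enorm_ge0//.
  by rewrite exprMn !enorm_sqr -normrX ger0_norm ?sqr_ge0// cauchy_schwarz.
rewrite mulr2n; lra.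
Qed.

Lemma enormN x : enorm (- x) = enorm x.
Proof. by rewrite !enormE dotNl dotC dotNl opprK. Qed.

Lemma enormB x y : enorm (x - y) = enorm (y - x).
Proof. by rewrite -enormN opprB. Qed.

Lemma enorm_triangle y x z : enorm (x - z) <= enorm (x - y) + enorm (y - z).
Proof. by have := enormD (x - y) (y - z); rewrite addrA subrK. Qed.

Lemma enorm0 : enorm (0 : 'rV[R]_d) = 0.
Proof. by rewrite enormE /dot big1 ?sqrtr0// => i _; rewrite mxE mul0r. Qed.

Lemma norm_le_enorm x : `|x| <= enorm x.
Proof.
apply/rV_norm_le => [|i]; first exact: enorm_ge0.
rewrite enormE -[leLHS]ger0_norm// -sqrtr_sqr ler_wsqrtr//.
rewrite -normrX ger0_norm ?sqr_ge0// /dot (bigD1 i)//= -expr2 lerDl sumr_ge0// => j _.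
by rewrite -expr2 sqr_ge0.
Qed.

Lemma enorm_le_norm x : enorm x <= d%:R * `|x|.
Proof.
have xi i : `|x ord0 i| <= `|x| by apply: (rV_norm_le x (normr_ge0 x)).1.
rewrite -(@ler_pXn2r _ 2)// ?nnegrE ?mulr_ge0 ?enorm_ge0//.
rewrite enorm_sqr; apply: (@le_trans _ _ (\sum_(i < d) `|x| ^+ 2)).
  apply: ler_sum => i _; rewrite -expr2 -[leLHS]ger0_norm ?sqr_ge0// normrX.
  by rewrite lerXn2r// nnegrE.
rewrite sumr_const card_ord exprMn -[leLHS]mulr_natl ler_wpM2r ?sqr_ge0//.
by rewrite -natrX ler_nat; case: d => // n; rewrite expnS leq_pmulr// expn1.
Qed.

(** A similarity is affine with invertible linear part: after normalization it
    preserves inner products, so the images of the standard basis form an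
    orthonormal basis, in which the image of x has the coordinates of x. *)
Lemma similarity_surj r (g : 'rV[R]_d -> 'rV[R]_d) : 0 < r -> similarity r g ->
  forall z, exists x, g x = z.
Proof.
move=> r0 gr; pose h x := r^-1 *: (g x - g 0).
have hh x y : dot (h x - h y) (h x - h y) = dot (x - y) (x - y).
  have -> : h x - h y = r^-1 *: (g x - g y).
    by rewrite /h -scalerBr; congr (_ *: _); rewrite opprB addrA subrK.
  rewrite dotZl dotC dotZl -enorm_sqr gr exprMn enorm_sqr.
  by field; rewrite gt_eqF.
have h0 : h 0 = 0 by rewrite /h subrr scaler0.
have h1 x : dot (h x) (h x) = dot x x.
  by have := hh x 0; rewrite h0 !subr0.
have hdot x y : dot (h x) (h y) = dot x y.
  by have := hh x y; rewrite !dotBB !h1; lra.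
have hE x : h x = r^-1 *: (g x - g 0) by [].
clearbody h.
pose e i : 'rV[R]_d := delta_mx ord0 i.
have dote x i : dot x (e i) = x ord0 i.
  rewrite /dot (bigD1 i)//= big1 ?addr0 => [|j /negPf ji]; rewrite /e mxE ?eqxx ?mulr1//.
  by rewrite ji mulr0.
pose A : 'M[R]_d := \matrix_(i, j) h (e i) ord0 j.
have AAT : A *m A^T = 1%:M.
  apply/matrixP => i j; rewrite !mxE.
  under eq_bigr do rewrite !mxE.
  by rewrite -/(dot (h (e i)) (h (e j))) hdot dote /e !mxE eqxx eq_sym.
have ATA := mulmx1C AAT.
have hA x : h x = x *m A.
  suff E : h x *m A^T = x by rewrite -{2}E -mulmxA ATA mulmx1.
  apply/rowP => j; rewrite !mxE; under eq_bigr do rewrite !mxE.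
  by rewrite -/(dot (h x) (h (e j))) hdot dote.
move=> z; exists ((r^-1 *: (z - g 0)) *m A^T).
have := hA ((r^-1 *: (z - g 0)) *m A^T).
rewrite -mulmxA ATA mulmx1 hE => /(congr1 (fun x => r *: x)).
rewrite !scalerA divff ?gt_eqF// !scale1r => /(congr1 (fun x => x + g 0)).
by rewrite !subrK.
Qed.

End euclid.

(** Pigeonhole on a grid of mesh h. *)
Lemma packing (R : realType) (d : nat) (V : eqType) (S : seq V)
    (g : V -> 'rV[R]_d) (z : 'rV[R]_d) (D h : R) :
  0 < h -> 0 <= D -> uniq S -> (forall y, y \in S -> `|g y - z| <= D) ->
  (forall y y', y \in S -> y' \in S -> y != y' -> h <= `|g y - g y'|) ->
  (size S <= (Num.truncn (2 * D / h)).+1 ^ d)%N.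
Proof.
move=> h0 D0 uS SD Sh; set m := Num.truncn _.
pose t y i := (g y ord0 i - z ord0 i + D) / h.
have t_itv y i : y \in S -> 0 <= t y i <= 2 * D / h.
  move=> yS; have := (rV_norm_le (g y - z) D0).1 (SD y yS) i.
  rewrite !mxE ler_norml => /andP[l1 l2].
  rewrite divr_ge0 ?(ltW h0)//=; last by lra.
  by rewrite ler_wpM2r ?invr_ge0 ?(ltW h0)//; lra.
pose cell y : {ffun 'I_d -> 'I_m.+1} := [ffun i => inord (Num.truncn (t y i))].
have cell_inj : {in S &, injective cell}.
  move=> y y' yS y'S cc; apply/eqP; apply: contraT => yy.
  have := Sh _ _ yS y'S yy; rewrite leNgt => /negP; case.
  suff tt i : `|(g y - g y') ord0 i| < h.
    rewrite [`|_|]/Num.Def.normr/= mx_normrE.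
    by apply/bigmax_ltP; split => // -[j i] _ /=; rewrite ord1; exact: tt.
  have := congr1 (fun c : {ffun 'I_d -> 'I_m.+1} => nat_of_ord (c i)) cc.
  have /andP[t0 t1] := t_itv y i yS; have /andP[t0' t1'] := t_itv y' i y'S.
  rewrite !ffunE !inordK ?ltnS ?le_truncn// => te.
  have := truncn_itv t0; have := truncn_itv t0'; rewrite te.
  set n := _%:R; set n1 := _%:R => /andP[a1 a2] /andP[b1 b2].
  have n1E : n1 = n + 1 by rewrite /n1 /n natr1.
  have -> : (g y - g y') ord0 i = h * (t y i - t y' i).
    by rewrite !mxE /t; field; rewrite gt_eqF.
  rewrite normrM gtr0_norm// -[ltRHS]mulr1 ltr_pM2l// ltr_norml; lra.
have -> : (m.+1 ^ d = #|{ffun 'I_d -> 'I_m.+1}|)%N by rewrite card_ffun !card_ord.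
rewrite -(size_map cell) cardE; apply: uniq_leq_size; first by rewrite map_inj_in_uniq.
by move=> c _; rewrite mem_enum.
Qed.

(** * Covers and contents *)

Section covers.
Variables (R : realType) (d : nat).
Implicit Types (A C : set 'rV[R]_d) (s delta : R).

Lemma ediam0 : ediam (set0 : set 'rV[R]_d) = -oo%E.
Proof.
rewrite /ediam -[RHS](@ereal_sup0 R); congr ereal_sup.
by apply/seteqP; split => // z [x [y [[]]]].
Qed.

(** The form in which upper bounds for both dimensions are obtained. *)
Definition covers_at_rate s A : Prop := exists2 B : R, 0 < B &
  forall delta, 0 < delta < 1 -> exists (m : nat) (C : 'I_m -> set 'rV[R]_d),
    [/\ A `<=` \bigcup_i C i, (forall i, (ediam (C i) <= delta%:E)%E) &
        m%:R <= B * delta `^ (- s)].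

(** Positivity of the s-dimensional Hausdorff content, computed with covering sets
    of diameter at most 1. *)
Definition content_positive s A : Prop := exists2 c : R, 0 < c &
  forall C : nat -> set 'rV[R]_d,
    A `<=` \bigcup_n C n -> (forall n, (ediam (C n) <= 1)%E) ->
    (c%:E <= \sum_(0 <= n <oo) diam_weight s (C n))%E.

End covers.

(** * Coding the limit set *)

Section coding.
Variables (R : realType) (N d M : nat) (f : 'I_N -> 'rV[R]_d -> 'rV[R]_d) (r : 'I_N -> R).
Hypotheses (r01 : forall i, 0 < r i < 1) (hf : forall i, similarity (r i) (f i)).
Implicit Types (a : edge M -> 'I_N) (Q : nat -> edge M) (x : seq 'I_N) (y z : 'rV[R]_d).

Definition fmap x y : 'rV[R]_d := foldr (fun i => f i) y x.

Local Notation ratio := (ratio r).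

Let r0 i : 0 < r i. Proof. by have /andP[] := r01 i. Qed.

Lemma fmap_cat x x' y : fmap (x ++ x') y = fmap x (fmap x' y).
Proof. exact: foldr_cat. Qed.

Lemma ratio_cat x x' : ratio (x ++ x') = ratio x * ratio x'.
Proof. exact: big_cat. Qed.

Lemma enorm_fmap x y z : enorm (fmap x y - fmap x z) = ratio x * enorm (y - z).
Proof.
elim: x => [|i x IH] /=; first by rewrite /ratio big_nil mul1r.
by rewrite hf IH mulrA /ratio big_cons.
Qed.

Lemma fmap_surj x z : exists y, fmap x y = z.
Proof.
elim: x z => [|i x IH] z /=; first by exists z.
by have [y <-] := similarity_surj (r0 i) (hf i) z; have [y' <-] := IH y; exists y'.
Qed.

Definition rmax : R := \big[Num.max/0]_i r i.

Lemma rmax_lt1 : rmax < 1.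
Proof. by apply/bigmax_ltP; split => // i _; have /andP[] := r01 i. Qed.

Lemma rmax_ge0 : 0 <= rmax. Proof. exact: bigmax_ge_id. Qed.

Lemma le_rmax i : r i <= rmax. Proof. exact: le_bigmax. Qed.

Lemma ratio_le_rmax x : ratio x <= rmax ^+ size x.
Proof.
elim: x => [|i x IH]; first by rewrite /ratio big_nil.
rewrite /ratio big_cons exprS ler_pM//; [exact: ltW | |exact: le_rmax].
exact/ltW/prodr_gt0.
Qed.

Lemma rmax_small (e : R) : 0 < e -> exists n, rmax ^+ n < e.
Proof.
move=> e0; have : rmax ^+ n @[n --> \oo] --> (0 : R).
  by apply: cvg_expr; rewrite ger0_norm ?rmax_ge0// rmax_lt1.
move=> /cvgr0Pnorm_lt /(_ e e0) [n _ /(_ n (leqnn _))] /= h; exists n.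
by apply: le_lt_trans h; exact: ler_norm.
Qed.

Lemma orbit_bounded : exists2 rad : R, 1 <= rad & forall x, enorm (fmap x 0) <= rad.
Proof.
pose A := \sum_i enorm (f i 0).
have A0 : 0 <= A by apply: sumr_ge0 => i _; exact: enorm_ge0.
have d0 : 0 < 1 - rmax by rewrite subr_gt0 rmax_lt1.
exists (A / (1 - rmax) + 1) => [|x]; first by rewrite lerDr divr_ge0// ltW.
apply: (@le_trans _ _ (A / (1 - rmax))); last by rewrite lerDl.
elim: x => [|i x IH] /=; first by rewrite enorm0 divr_ge0// ltW.
have fi : enorm (f i 0) <= A.
  by rewrite /A (bigD1 i)//= lerDl sumr_ge0// => j _; exact: enorm_ge0.
have := enorm_triangle (f i 0) (f i (fmap x 0)) 0; rewrite !subr0 hf subr0 => tr.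
have h : r i * enorm (fmap x 0) <= rmax * (A / (1 - rmax)).
  by apply: ler_pM => //; [exact: ltW | exact: enorm_ge0 | exact: le_rmax].
apply: le_trans tr _; apply: le_trans (lerD h fi) _.
rewrite le_eqVlt; apply/orP; left; apply/eqP; field; rewrite gt_eqF//.
Qed.

Definition code a Q (n : nat) : seq 'I_N := [seq a (Q k) | k <- iota 0 n].

Lemma size_code a Q n : size (code a Q n) = n.
Proof. by rewrite size_map size_iota. Qed.

Lemma codeS a Q n : code a Q n.+1 = rcons (code a Q n) (a (Q n)).
Proof. by rewrite /code -addn1 iotaD map_cat cats1. Qed.

Lemma code_cat a Q n m : (n <= m)%N -> exists x, code a Q m = code a Q n ++ x.
Proof.
move=> nm; rewrite -(subnKC nm) /code iotaD map_cat.
by exists [seq a (Q k) | k <- iota (0 + n) (m - n)].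
Qed.

Lemma path_pointE a Q n : path_point f a Q n = fmap (code a Q n) 0.
Proof. by rewrite /path_point /fmap /code foldr_map. Qed.

Lemma code_read a Q n : root_path Q -> code a Q n = read a [::] (Q n).1.
Proof.
move=> [Q0 QS]; elim: n => [|n IH]; first by rewrite Q0.
rewrite codeS QS -[in RHS]cats1 read_cat IH /= cats1.
by rewrite -(surjective_pairing (Q n)).
Qed.

Lemma code_present a Q n : root_path Q -> present a [::] (code a Q n).
Proof. by move=> Qr; rewrite code_read// present_read. Qed.

Lemma path_through (V : nat -> seq 'I_M) : (forall i, (i <= size (V i))%N) ->
  (forall i, prefix (V i) (V i.+1)) ->
  exists2 Q, root_path Q & forall i, (Q (size (V i))).1 = V i.
Proof.
move=> sV pV; have c0 : 'I_M by move: (sV 1%N); case: (V 1%N).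
have VV i j : (i <= j)%N -> prefix (V i) (V j).
  elim: j => [|j IH]; first by rewrite leqn0 => /eqP ->; exact: prefix_refl.
  rewrite leq_eqVlt => /predU1P[->|/IH pj]; first exact: prefix_refl.
  exact: prefix_trans pj (pV j).
have tV n i j : (i <= j)%N -> (n <= size (V i))%N -> take n (V j) = take n (V i).
  by move=> ij ni; have /prefixP[v ->] := VV _ _ ij; rewrite takel_cat.
exists (fun k => (take k (V k.+1), nth c0 (V k.+1) k)) => /=.
  split => [|k]; first by rewrite take0.
  by rewrite -take_nth//= (tV k.+1 k.+1).
by move=> i; rewrite (tV _ i) ?take_size// leqW.
Qed.

Lemma code_close rad a Q n m : (forall x, enorm (fmap x 0) <= rad) -> (n <= m)%N ->
  enorm (path_point f a Q m - path_point f a Q n) <= rad * ratio (code a Q n).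
Proof.
move=> radP nm; rewrite !path_pointE; have [x ->] := code_cat a Q nm.
rewrite fmap_cat enorm_fmap subr0 mulrC ler_wpM2r//.
exact/ltW/ratio_gt0.
Qed.

Lemma limit_close rad a Q z : (forall x, enorm (fmap x 0) <= rad) ->
  path_point f a Q n @[n --> \oo] --> z ->
  forall n, enorm (z - fmap (code a Q n) 0) <= rad * ratio (code a Q n).
Proof.
move=> radP Qz n; apply/ler_addgt0Pr => e e0.
have e1 : 0 < e / d.+1%:R by rewrite divr_gt0.
move/cvgrPdist_lt : Qz => /(_ _ e1) [m0 _ hm].
have := hm (maxn m0 n) (leq_maxl _ _) => /= zm.
apply: le_trans (enorm_triangle (path_point f a Q (maxn m0 n)) _ _) _.
rewrite [leRHS]addrC lerD//.
  apply: le_trans (enorm_le_norm _) _.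
  apply: le_trans (_ : d.+1%:R * `|z - path_point f a Q (maxn m0 n)| <= _).
    by rewrite ler_wpM2r// ler_nat.
  by rewrite mulrC -ler_pdivlMr// ltW.
by rewrite -path_pointE; apply: code_close; rewrite ?leq_maxr.
Qed.

Lemma path_cvg a Q : exists z, path_point f a Q n @[n --> \oo] --> z.
Proof.
have [rad rad1 radP] := orbit_bounded.
have rad0 : 0 < rad by exact: lt_le_trans rad1.
suff cv : cvg (path_point f a Q n @[n --> \oo]).
  by exists (lim (path_point f a Q n @[n --> \oo])).
apply: cauchy_cvg; apply: cauchy_exP => e e0.
have [n nE] := rmax_small (divr_gt0 e0 rad0).
exists (path_point f a Q n); exists n => // m /= nm.
rewrite -ball_normE /ball_ /= distrC.
apply: le_lt_trans (norm_le_enorm _) _.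
apply: le_lt_trans (code_close _ _ radP nm) _.
rewrite mulrC -ltr_pdivlMr//; apply: le_lt_trans nE.
by apply: le_trans (ratio_le_rmax _) _; rewrite size_code.
Qed.

Definition rmin : R := \big[Num.min/1]_i r i.

Lemma rmin_gt0 : 0 < rmin.
Proof. by apply/lt_bigmin. Qed.

Lemma rmin_le i : rmin <= r i. Proof. exact: bigmin_le_cond. Qed.

Lemma ediam_le (A : set 'rV[R]_d) (e : R) :
  (forall y z, A y -> A z -> enorm (y - z) <= e) -> (ediam A <= e%:E)%E.
Proof.
move=> Ae; apply: ge_ereal_sup => _ [y [z [Ay Az ->]]].
by rewrite lee_fin Ae.
Qed.

Lemma le_ediam (A : set 'rV[R]_d) y z : A y -> A z ->
  ((enorm (y - z))%:E <= ediam A)%E.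
Proof. by move=> Ay Az; apply: ereal_sup_ubound; exists y, z. Qed.

(** The words of ratio comparable with delta that are present give a cover of
    the limit set at scale delta, and each of them contributes a multiple of
    delta^s to the mass. *)
Lemma covering_bound a (s B : R) : 0 <= s -> (forall n, mass r s n a <= B) ->
  covers_at_rate s (limit_set f a).
Proof.
move=> s0 massB; have [rad rad1 radP] := orbit_bounded.
have rad0 : 0 < rad by exact: lt_le_trans rad1.
pose b := rmin / (2 * rad); have b0 : 0 < b by rewrite divr_gt0 ?rmin_gt0 ?mulr_gt0.
have B1 : 0 < Num.max 1 B by rewrite lt_max ltr01.
exists (Num.max 1 B * b `^ (- s)) => [|delta /andP[delta0 delta1]].
  by rewrite mulr_gt0// powR_gt0.
pose eta := delta / (2 * rad).
have eta0 : 0 < eta by rewrite divr_gt0// mulr_gt0.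
have eta1 : eta < 1 by rewrite ltr_pdivrMr ?mulr_gt0//; lra.
have [n0 n0E] := rmax_small eta0.
pose good x := present a [::] x && (rmin * eta <= ratio x <= eta).
pose S := flatten [seq [seq x <- allwords N k | good x] | k <- iota 0 n0.+1].
exists (size S), (fun i => [set z | enorm (z - fmap (nth [::] S i) 0) <= rad * eta]).
split.
- move=> z [Q [Qr Qz]].
  have ex : exists n, ratio (code a Q n) <= eta.
    exists n0; apply: le_trans (ltW n0E).
    by apply: le_trans (ratio_le_rmax _) _; rewrite size_code.
  (* At the first time that the ratio drops below eta, it is still at least
     rmin eta. *)
  case: (ex_minnP ex) => n nE nmin.
  have nn0 : (n <= n0)%N.
    apply: nmin; apply: le_trans (ltW n0E).
    by apply: le_trans (ratio_le_rmax _) _; rewrite size_code.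
  have lo : rmin * eta <= ratio (code a Q n).
    case: n nE nmin {nn0} => [|n] nE nmin.
      by move: nE; rewrite /ratio big_nil leNgt eta1.
    rewrite codeS -cats1 ratio_cat [leRHS]mulrC {1}/ratio big_seq1.
    apply: ler_pM; [exact/ltW/rmin_gt0 | exact: ltW | exact: rmin_le |].
    rewrite leNgt; apply/negP => lt.
    by have := nmin n (ltW lt); rewrite ltnn.
  have cS : code a Q n \in S.
    apply/flattenP; exists [seq x <- allwords N n | good x].
      by apply/mapP; exists n; rewrite ?mem_iota.
    by rewrite mem_filter mem_allwords size_code eqxx /good code_present// lo nE.
  have iS : (index (code a Q n) S < size S)%N by rewrite index_mem.
  exists (Ordinal iS) => //=; rewrite nth_index//.
  by apply: le_trans (limit_close radP Qz n) _; rewrite ler_pM2l.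
- move=> i; apply: ediam_le => y z /= yi zi.
  apply: le_trans (enorm_triangle (fmap (nth [::] S i) 0) _ _) _.
  rewrite [X in _ + X]enormB.
  have -> : delta = rad * eta + rad * eta by rewrite /eta; field; rewrite gt_eqF.
  exact: lerD.
- have p0 : 0 < (b * delta) `^ s by rewrite powR_gt0// mulr_gt0.
  suff sB : (size S)%:R * (b * delta) `^ s <= B.
    rewrite -mulrA -powRM ?(ltW b0) ?(ltW delta0)// powRN ler_pdivlMr//.
    by apply: le_trans sB _; rewrite le_max lexx orbT.
  apply: le_trans (massB n0.+1).
  have -> : mass r s n0.+1 a =
      \sum_(k <- iota 0 n0.+1) \sum_(x <- allwords N k | present a [::] x) ratio x `^ s.
    by rewrite -[n0.+1 in RHS]subn0 -/(index_iota 0 n0.+1) big_mkord.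
  apply: (@le_trans _ _ (\sum_(x <- S) (b * delta) `^ s)).
    by rewrite big_const_seq count_predT iter_addr_0 mulr_natl.
  rewrite /S big_flatten big_map; apply: ler_sum => k _.
  rewrite big_filter big_mkcond [leRHS]big_mkcond; apply: ler_sum => x _.
  rewrite /good; case: present => //=; case: ifP => [/andP[lo _]|_]; last exact: powR_ge0.
  apply: ge0_ler_powR; rewrite ?nnegrE//.
  - by rewrite mulr_ge0// ltW.
  - exact/ltW/ratio_gt0.
  - by apply: le_trans lo; rewrite /b /eta mulrAC -mulrA.
Qed.

End coding.

(** * Packing cylinders under the open set condition *)

Section open_set.
Variables (R : realType) (N d : nat) (f : 'I_N -> 'rV[R]_d -> 'rV[R]_d) (r : 'I_N -> R).
Hypotheses (r01 : forall i, 0 < r i < 1) (hf : forall i, similarity (r i) (f i)).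
Variable U : set 'rV[R]_d.
Hypotheses (U0 : U !=set0) (oU : open U) (oscU : open_set_condition f U).
Implicit Types (x y : seq 'I_N).
Local Notation ratio := (ratio r).
Local Notation fmap := (fmap f).

Let r0 i : 0 < r i. Proof. by have /andP[] := r01 i. Qed.

Lemma fmap_sub x z : U z -> U (fmap x z).
Proof.
move=> Uz; elim: x => //= i x IH; case: oscU => fU _ _.
by apply: (fU i); exists (fmap x z).
Qed.

Lemma sim_inj i (y z : 'rV[R]_d) : f i y = f i z -> y = z.
Proof.
move=> fyz; have := hf i y z; rewrite fyz subrr enorm0 => /esym/eqP.
rewrite mulf_eq0 gt_eqF//= => /eqP yz; apply/eqP; rewrite -subr_eq0 -normr_eq0.
by rewrite eq_le normr_ge0 andbT -yz norm_le_enorm.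
Qed.

Lemma cylinders_disjoint x y z z' : size x = size y -> x != y -> U z -> U z' ->
  fmap x z <> fmap y z'.
Proof.
elim: x y => [|i x IH] [|j y] //= [sxy] xy Uz Uz'.
have [ij|ij] := eqVneq i j.
  rewrite -ij => /sim_inj; apply: IH => //.
  by apply: contraNneq xy => ->; rewrite ij.
case: oscU => _ dis _ e; have : (f i @` U `&` f j @` U) (f i (fmap x z)).
  by split; [exists (fmap x z) | rewrite e; exists (fmap y z')] => //; exact: fmap_sub.
by rewrite dis.
Qed.

(** If two centers were too close, the second one would be the image under the
    first map of a point of U, by surjectivity, and the images of U would meet. *)
Lemma centers_separated : exists q : 'rV[R]_d, exists2 e : R, 0 < e &
  forall x y, size x = size y -> ratio x = ratio y -> x != y ->
    e * ratio x <= enorm (fmap x q - fmap y q).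
Proof.
have [q Uq] := U0.
have /nbhs_ballP[e /= e0 eU] : nbhs q U by exact: open_nbhs_nbhs.
exists q, e => // x y sxy rxy xy; rewrite leNgt; apply/negP => lt.
have [z zE] := fmap_surj r01 hf x (fmap y q).
have : U z.
  apply: eU; rewrite -ball_normE /ball_ /=; apply: le_lt_trans (norm_le_enorm _) _.
  by rewrite -(ltr_pM2r (ratio_gt0 r01 x)) mulrC -(enorm_fmap hf) zE.
by move=> Uz; apply: (cylinders_disjoint sxy xy Uz Uq).
Qed.

Lemma enormZ (c : R) (z : 'rV[R]_d) : 0 <= c -> enorm (c *: z) = c * enorm z.
Proof.
move=> c0; rewrite !enormE dotZl dotC dotZl mulrA -expr2 sqrtrM ?sqr_ge0//.
by rewrite sqrtr_sqr ger0_norm.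
Qed.

(** Cylinders of the same generation and the same ratio eta that meet a set of
    diameter at most b eta have well-separated centers in a ball of radius
    comparable with eta. *)
Lemma few_cylinders (rad b : R) : 0 <= rad -> 0 <= b -> exists Kp : nat,
  forall (S : seq (seq 'I_N)) (n : nat) (eta : R) (C : set 'rV[R]_d),
    uniq S -> 0 < eta -> (ediam C <= (b * eta)%:E)%E ->
    (forall x, x \in S -> [/\ size x = n, ratio x = eta &
       exists2 z, C z & enorm (z - fmap x 0) <= rad * eta]) ->
    (size S <= Kp)%N.
Proof.
move=> rad0 b0; have [q [e e0 sep]] := centers_separated.
pose D := 2 * enorm q + 2 * rad + b; pose h := e / d.+1%:R.
have D0 : 0 <= D by rewrite !addr_ge0// mulr_ge0// enorm_ge0.
have h0 : 0 < h by rewrite divr_gt0.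
exists ((Num.truncn (2 * D / h)).+1 ^ d)%N => S n eta C uS eta0 dC SP.
case: S uS SP => [//|x0 S'] uS SP; set S := x0 :: S' in uS SP *.
pose g x := eta^-1 *: fmap x q.
have ie0 : 0 <= eta^-1 by rewrite invr_ge0 ltW.
have gB x y : enorm (g x - g y) = eta^-1 * enorm (fmap x q - fmap y q).
  by rewrite /g -scalerBr enormZ.
apply: (packing (g := g) (z := g x0) h0 D0 uS) => [x xS|x y xS yS xy].
  apply: le_trans (norm_le_enorm _) _; rewrite gB ler_pdivrMl// mulrC.
  have [_ rx [z Cz zx]] := SP x xS.
  have [_ rx0 [z0 Cz0 zx0]] := SP x0 (mem_head _ _).
  apply: le_trans (enorm_triangle (fmap x 0) _ _) _.
  apply: le_trans (lerD (lexx _) (enorm_triangle z _ _)) _.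
  apply: le_trans (lerD (lexx _) (lerD (lexx _) (enorm_triangle z0 _ _))) _.
  apply: le_trans (lerD (lexx _) (lerD (lexx _) (lerD (lexx _) (enorm_triangle (fmap x0 0) _ _)))) _.
  rewrite !(enorm_fmap hf) rx rx0 subr0 sub0r enormN.
  have zz : enorm (z - z0) <= b * eta.
    by rewrite -lee_fin; apply: le_trans dC; exact: le_ediam.
  rewrite [enorm (fmap x 0 - z)]enormB /D; lra.
have [sx rx _] := SP x xS; have [sy ry _] := SP y yS.
have := sep x y; rewrite sx sy rx ry => /(_ erefl erefl xy) exy.
rewrite /h ler_pdivrMr// mulrC.
apply: le_trans (_ : enorm (g x - g y) <= _).
  by rewrite gB ler_pdivlMl// mulrC.
apply: le_trans (enorm_le_norm _) _.
by rewrite ler_wpM2r// ler_nat.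
Qed.

End open_set.

(** * A lower bound for the content of the limit set *)

Section flow_limit.
Variables (R : realType) (N M : nat) (W : seq (seq 'I_N)) (lam : R).
Variable a : edge M -> 'I_N.
Hypothesis lam1 : 1 <= lam.

Definition flow_lim (u : seq 'I_M) : R := limn (fun j => flow W lam j u a).

Let lam0 : 0 < lam. Proof. exact: lt_le_trans lam1. Qed.

Lemma flow_cvg u : flow W lam j u a @[j --> \oo] --> flow_lim u.
Proof.
apply: nonincreasing_is_cvgn; first exact: flow_noninc.
by exists 0 => _ [j _ <-]; exact: flow_ge0.
Qed.

Lemma flow_lim_ge c u : (forall j, c <= flow W lam j u a) -> c <= flow_lim u.
Proof. by move=> cj; apply: limr_ge; [exact: flow_cvg | exact: nearW]. Qed.

Lemma flow_lim_le1 u : flow_lim u <= 1.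
Proof. by apply: limr_le; [exact: flow_cvg | apply: nearW => j; exact: flow_le1]. Qed.

Lemma flow_lim_step u : flow_lim u <=
  lam^-1 * \sum_(x <- W) if present a u x then flow_lim (u ++ rep a u x) else 0.
Proof.
apply: (@ler_cvg_to _ \oo _ _ (fun j => flow W lam j.+1 u a)
  (fun j => lam^-1 * \sum_(x <- W)
     if present a u x then flow W lam j (u ++ rep a u x) a else 0)).
- by have := @flow_cvg u; rewrite -cvg_shiftS.
- apply: cvgMr; apply: cvg_big => [|x _]; first exact: add_continuous.
  by case: present; [exact: flow_cvg | exact: cvg_cst].
- by apply: nearW => j; rewrite /= ge_min lexx orbT.
Qed.

End flow_limit.

Section content.
Variables (R : realType) (N d M : nat) (f : 'I_N -> 'rV[R]_d -> 'rV[R]_d) (r : 'I_N -> R).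
Hypotheses (r01 : forall i, 0 < r i < 1) (hf : forall i, similarity (r i) (f i)).
Variable U : set 'rV[R]_d.
Hypotheses (U0 : U !=set0) (oU : open U) (oscU : open_set_condition f U).
Variables (K : nat) (W : seq (seq 'I_N)) (rho s : R).
Hypotheses (K0 : (0 < K)%N) (uW : uniq W) (sW : forall x, x \in W -> size x = K).
Hypotheses (rho01 : 0 < rho < 1) (rW : forall x, x \in W -> ratio r x = rho).
Hypothesis s0 : 0 < s.
Variable a : edge M -> 'I_N.
Implicit Types (x y : seq 'I_N) (u v : seq 'I_M).

Let lam : R := rho `^ (- s).

Let rho0 : 0 < rho. Proof. by case/andP: rho01. Qed.

Let lam_gt1 : 1 < lam.
Proof.
rewrite /lam powRN invf_gt1 ?powR_gt0//.
have -> : 1 = 1 `^ s :> R by rewrite powR1.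
by apply: gt0_ltr_powR; rewrite ?nnegrE ?ler01 ?ltW//; case/andP: rho01.
Qed.

Let lam1 : 1 <= lam. Proof. exact: ltW. Qed.
Let lam0 : 0 < lam. Proof. exact: lt_le_trans lam1. Qed.

Let lamV i : lam^-1 ^+ i = (rho ^+ i) `^ s.
Proof.
rewrite /lam powRN invrK -[LHS]powR_mulrn ?powR_ge0// -!powRrM mulrC powRrM.
by rewrite powR_mulrn// ltW.
Qed.

(** The generation at which cylinders have the size of a given set. The error e
    is needed for sets of diameter zero, whose weight vanishes. *)
Lemma level_exists (C : set 'rV[R]_d) (e : R) : 0 < e -> (ediam C <= 1)%E ->
  exists i, (ediam C <= (rho ^+ i)%:E)%E /\
    ((lam^-1 ^+ i)%:E <= lam%:E * diam_weight s C + e%:E)%E.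
Proof.
move=> e0 C1.
have small (x : R) q : 0 < q < 1 -> 0 < x -> exists i, q ^+ i < x.
  move=> /andP[q0 q1] x0; have : q ^+ n @[n --> \oo] --> (0 : R).
    by apply: cvg_expr; rewrite gtr0_norm.
  move=> /cvgr0Pnorm_lt /(_ x x0) [n _ /(_ n (leqnn _))] /= h; exists n.
  by apply: le_lt_trans h; exact: ler_norm.
have w0 : (0 <= lam%:E * diam_weight s C)%E.
  rewrite mule_ge0 ?lee_fin ?(ltW lam0)// /diam_weight.
  by case: ifP => // _; exact: poweR_ge0.
have tiny : (ediam C <= 0)%E -> exists i, (ediam C <= (rho ^+ i)%:E)%E /\
    ((lam^-1 ^+ i)%:E <= lam%:E * diam_weight s C + e%:E)%E.
  move=> C0; have [|i ie] := small e lam^-1 _ e0.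
    by rewrite invr_gt0 lam0 invf_lt1.
  exists i; split; first by apply: le_trans C0 _; rewrite lee_fin exprn_ge0// ltW.
  apply: (@le_trans _ _ e%:E); first by rewrite lee_fin ltW.
  by rewrite leeDr.
have [/tiny //|C0] := leP (ediam C) 0%E.
have [D DE] : exists D : R, ediam C = D%:E.
  by move: C0 C1; case: (ediam C) => [D|//|//] _ _; exists D.
rewrite DE lte_fin in C0; rewrite DE lee_fin in C1.
have Cn0 : C <> set0.
  by move=> CE; move: DE; rewrite CE ediam0.
have ex : exists i, rho ^+ i < D by exact: small.
case: (ex_minnP ex) => -[|i] iD imin; first by move: iD; rewrite expr0; lra.
have Di : D <= rho ^+ i by rewrite leNgt; apply/negP => /imin; rewrite ltnn.
exists i; split; first by rewrite DE lee_fin.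
apply: le_trans (_ : lam%:E * diam_weight s C <= _)%E; last by rewrite leeDl// lee_fin ltW.
rewrite /diam_weight asboolF// DE /= -EFinM lee_fin.
rewrite -ler_pdivrMl// -exprS lamV.
by apply: ge0_ler_powR; rewrite ?nnegrE ?exprn_ge0 ?ltW.
Qed.

Lemma blocks_cat i x y : y \in blocks W i -> x \in W -> y ++ x \in blocks W i.+1.
Proof.
elim: i y => [|i IH] y yW xW.
  move: yW; rewrite inE => /eqP ->; rewrite cat0s.
  by apply/allpairsP; exists (x, [::]); rewrite /= inE cats0 xW eqxx.
case/allpairsP: yW => -[w0 w] [w0W wW ->]; rewrite -catA.
by apply/allpairsP; exists (w0, w ++ x); split => //; exact: IH.
Qed.


Section avoidance.
Variables (level : nat -> nat) (bad : nat -> seq (seq 'I_N)) (u : seq 'I_M).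

(** In the application, the words of [bad n] are those of generation [level n]
    whose cylinders come close to the n-th set of a cover. *)
Definition bad_weight (n : nat) y : R :=
  \sum_(y' <- bad n | prefix y y') lam^-1 ^+ level n.

Definition total_weight y : \bar R := (\sum_(0 <= n <oo) (bad_weight n y)%:E)%E.

Let lamV0 i : 0 < lam^-1 ^+ i. Proof. by rewrite exprn_gt0// invr_gt0. Qed.

Lemma bad_weight_ge0 n y : 0 <= bad_weight n y.
Proof. by apply: sumr_ge0 => x _; exact: ltW. Qed.

Let count_prefix y y' : \sum_(x <- W) (prefix (y ++ x) y')%:R <= (prefix y y')%:R :> R.
Proof.
have [/hasP[x xW px]|nx] := boolP (has (fun x => prefix (y ++ x) y') W); last first.
  rewrite big_seq big1 ?ler0n// => x xW; move/hasPn : nx => /(_ x xW) /negPf -> //.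
have py : prefix y y' by apply: prefix_trans px; exact: prefix_prefix.
rewrite py (bigD1_seq x)//= px big_seq_cond big1 ?addr0// => x' /andP[x'W xx].
case: (boolP (prefix (y ++ x') y')) => // px'.
move: px px' xx; rewrite !prefixE !size_cat (sW xW) (sW x'W) => /eqP -> /eqP/eqP.
by rewrite eqseq_cat// eqxx /= eq_sym => /eqP ->; rewrite eqxx.
Qed.

Lemma total_weight_step y : (\sum_(x <- W) total_weight (y ++ x) <= total_weight y)%E.
Proof.
rewrite -nneseries_sum; last by move=> x n _; rewrite lee_fin bad_weight_ge0.
apply: lee_nneseries => n _; first by rewrite sume_ge0// => x _; rewrite lee_fin bad_weight_ge0.
rewrite sumEFin lee_fin /bad_weight.
under eq_bigr do rewrite big_mkcond.
rewrite exchange_big [leRHS]big_mkcond; apply: ler_sum => y' _ /=.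
apply: (@le_trans _ _ (lam^-1 ^+ level n * \sum_(x <- W) (prefix (y ++ x) y')%:R)).
  rewrite mulr_sumr; apply: ler_sum => x _.
  by case: prefix; rewrite ?mulr1 ?mulr0.
apply: le_trans (_ : lam^-1 ^+ level n * (prefix y y')%:R <= _).
  by rewrite ler_wpM2l// ltW.
by case: prefix; rewrite ?mulr1 ?mulr0.
Qed.

Local Notation fl := (flow_lim W lam a).

(** The bad weight below y is at least the sum of the bad weights below its
    extensions, while the flow is at most the corresponding sum of flows, so that
    a strict inequality is inherited by some child. *)
Lemma good_child i y v : (total_weight y < (lam^-1 ^+ i * fl v)%:E)%E ->
  exists2 x, x \in W & present a v x /\
    (total_weight (y ++ x) < (lam^-1 ^+ i.+1 * fl (v ++ rep a v x))%:E)%E.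
Proof.
move=> lt; apply: contrapT => no.
have ge x : x \in W -> present a v x ->
    ((lam^-1 ^+ i.+1 * fl (v ++ rep a v x))%:E <= total_weight (y ++ x))%E.
  by move=> xW px; rewrite leNgt; apply/negP => h; apply: no; exists x.
move: lt; rewrite ltNge => /negP; apply.
apply: le_trans (total_weight_step y).
apply: (@le_trans _ _ (\sum_(x <- W)
  (lam^-1 ^+ i.+1 * if present a v x then fl (v ++ rep a v x) else 0)%:E)%E).
  rewrite sumEFin lee_fin -mulr_sumr exprSr -mulrA ler_wpM2l ?(ltW (lamV0 i))//.
  exact: flow_lim_step.
rewrite !big_seq; apply: lee_sum => x xW; case: ifPn => px; first exact: ge.
by rewrite mulr0 nneseries_ge0// => n _ _; rewrite lee_fin bad_weight_ge0.
Qed.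

(** A bad word blocks the full capacity of its vertex. *)
Lemma bad_excluded n y v : y \in bad n ->
  ~ (total_weight y < (lam^-1 ^+ level n * fl v)%:E)%E.
Proof.
move=> yn; apply/negP; rewrite -leNgt.
apply: (@le_trans _ _ (bad_weight n y)%:E).
  rewrite lee_fin /bad_weight (big_rem y)//= prefix_refl.
  rewrite ler_wpDr//; first by apply: sumr_ge0 => x _; exact: ltW.
  by rewrite -[leRHS]mulr1 ler_wpM2l ?(ltW (lamV0 _))// flow_lim_le1.
have b0 k : (0 <= (bad_weight k y)%:E)%E by rewrite lee_fin bad_weight_ge0.
apply: le_trans (nneseries_lim_ge n.+1 (fun k _ _ => b0 k)).
by rewrite big_nat_recr//= leeDr// sume_ge0.
Qed.

Let invariant (c : nat * seq 'I_N * seq 'I_M) : Prop :=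
  [/\ c.1.2 \in blocks W c.1.1, read a u c.2 = c.1.2 &
      (total_weight c.1.2 < (lam^-1 ^+ c.1.1 * fl (u ++ c.2))%:E)%E].

Lemma avoiding_path : (total_weight [::] < (fl u)%:E)%E ->
  exists Q, root_path Q /\ forall i, exists n y v,
    [/\ code a Q n = read a [::] u ++ y, y \in blocks W i &
        (total_weight y < (lam^-1 ^+ i * fl v)%:E)%E].
Proof.
move=> start.
have inv0 : invariant (0%N, [::], [::]).
  by split => //=; rewrite cats0 expr0 mul1r.
pose step (c c' : {c | invariant c}) : Prop := (sval c').1.1 = (sval c).1.1.+1 /\
  exists2 v, (size v = K) & (sval c').2 = (sval c).2 ++ v.
have next (c : {c | invariant c}) : {c' | step c c'}.
  apply: cid; case: c => [[[i y] v] inv]; case: (inv) => /= yW yr lt.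
  have [x xW [px xlt]] := good_child lt.
  have inv' : invariant (i.+1, y ++ x, v ++ rep a (u ++ v) x).
    split => /=; first exact: blocks_cat.
      by rewrite read_cat yr read_rep.
    by rewrite catA.
  exists (exist _ _ inv'); split => //=.
  by exists (rep a (u ++ v) x) => //; rewrite size_rep// sW.
have [F [F0 FS]] := dependent_choice next (exist _ _ inv0).
pose V i := u ++ (sval (F i)).2.
have Fi i : (sval (F i)).1.1 = i.
  by elim: i => [|i IH]; [rewrite F0 | have [-> _] := FS i; rewrite IH].
have sV i : (i <= size (V i))%N.
  rewrite /V size_cat; apply: leq_trans (leq_addl _ _).
  elim: i => // i IH; have [_ [v vK ->]] := FS i.
  by rewrite size_cat vK -addn1 leq_add.
have pV i : prefix (V i) (V i.+1).
  by have [_ [v _ E]] := FS i; rewrite /V E catA prefix_prefix.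
have [Q Qr QV] := path_through sV pV.
exists Q; split => // i; exists (size (V i)), (sval (F i)).1.2, (u ++ (sval (F i)).2).
have [yW yr lt] := proj2_sig (F i); rewrite /= Fi in yW yr lt.
split => //; rewrite code_read// QV /V read_cat; congr (_ ++ _).
exact: yr.
Qed.

End avoidance.

Lemma code_ratio i y : y \in blocks W i -> ratio r y = rho ^+ i.
Proof. by move=> yW; apply: (prod_blocks (g := r)) yW. Qed.

(** A cover by sets of small total weight leaves out a point: at most boundedly
    many cylinders of the appropriate generation come close to each of its sets,
    so that the words of these cylinders have total weight less than the flow. *)
Lemma content_lower u c : 0 < c -> (forall j, c <= flow W lam j u a) ->
  content_positive s (limit_set f a).
Proof.
move=> c0 cflow; have [rad rad1 radP] := orbit_bounded r01 hf.
have rad0 : 0 < rad by exact: lt_le_trans rad1.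
set xu := read a [::] u.
have xu0 : 0 < ratio r xu by exact: ratio_gt0.
have b0 : 0 <= (ratio r xu)^-1 by rewrite invr_ge0 ltW.
have [Kp KpP] := few_cylinders r01 hf U0 oU oscU (ltW rad0) b0.
pose k : R := Kp%:R + 1; have k0 : 0 < k by rewrite ltr_wpDl.
exists (c / (4 * k * lam)) => [|C FC C1]; first by rewrite divr_gt0// !mulr_gt0.
rewrite leNgt; apply/negP => small.
(* The errors e n add up to e0, so that together they cost at most c / 4; so does
   the weight of the cover. *)
pose e0 := c / (4 * k); have e00 : 0 < e0 by rewrite divr_gt0// mulr_gt0.
pose e n := e0 / (2 ^ n.+1)%:R.
have en n : 0 < e n by rewrite divr_gt0// ltr0n expn_gt0.
have [level levelP] := choice (fun n => level_exists (en n) (C1 n)).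
pose near n y := `[< exists2 z, C n z &
  enorm (z - fmap f (xu ++ y) 0) <= rad * ratio r (xu ++ y) >].
pose bad n := [seq y <- blocks W (level n) | near n y].
have size_bad n : (size (bad n) <= Kp)%N.
  rewrite -(size_map (cat xu)).
  apply: (KpP _ (size xu + level n * K)%N (ratio r xu * rho ^+ level n) (C n)).
  - rewrite map_inj_uniq ?filter_uniq ?(blocks_uniq uW sW)//.
    by move=> y y' /eqP; rewrite eqseq_cat// eqxx => /eqP.
  - by rewrite mulr_gt0// exprn_gt0.
  - by rewrite mulrA mulVf ?gt_eqF// mul1r; have [] := levelP n.
  - move=> _ /mapP[y + ->]; rewrite mem_filter => /andP[/asboolP yn yW].
    rewrite size_cat (size_blocks sW yW) ratio_cat (code_ratio yW); split => //.
    by move: yn; rewrite ratio_cat (code_ratio yW).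
have w0 n : (0 <= diam_weight s (C n))%E.
  by rewrite /diam_weight; case: ifP => // _; exact: poweR_ge0.
have total0 : (total_weight level bad [::] < (flow_lim W lam a u)%:E)%E.
  apply: (@lt_le_trans _ _ c%:E); last by rewrite lee_fin; apply: flow_lim_ge.
  apply: (@le_lt_trans _ _ (\sum_(0 <= n <oo) (k%:E *
      (lam%:E * diam_weight s (C n) + (e n)%:E)))%E).
    apply: lee_nneseries => n _; first by rewrite lee_fin bad_weight_ge0.
    apply: (@le_trans _ _ (k * lam^-1 ^+ level n)%:E).
      rewrite lee_fin /bad_weight; under eq_bigl do rewrite prefix0s.
      rewrite big_const_seq count_predT iter_addr_0 -[leLHS]mulr_natl.
      rewrite ler_wpM2r//; first by rewrite exprn_ge0// invr_ge0 ltW.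
      by apply: le_trans (_ : Kp%:R <= _); rewrite ?ler_nat// /k lerDl.
    by rewrite EFinM lee_wpmul2l ?lee_fin ?(ltW k0)//; have [] := levelP n.
  rewrite nneseriesZl; last first.
    by move=> n _; rewrite adde_ge0 ?lee_fin ?(ltW (en n))// mule_ge0 ?lee_fin// ltW.
  apply: (@le_lt_trans _ _ (k%:E * (lam%:E * (\sum_(0 <= n <oo) diam_weight s (C n)) + e0%:E))%E).
    rewrite lee_wpmul2l ?lee_fin ?(ltW k0)// -nneseriesZl//.
    apply: epsilon_trick; last exact: ltW.
    by move=> n; rewrite mule_ge0// lee_fin ltW.
  have S0 : (0 <= \sum_(0 <= n <oo) diam_weight s (C n))%E by exact: nneseries_ge0.
  move: small S0; case: (\sum_(0 <= n <oo) _)%E => [S||]//.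
  rewrite !lte_fin !lee_fin => Ssmall S0.
  have h1 : k * (lam * S) < c / 4.
    rewrite mulrA -ltr_pdivlMl ?mulr_gt0//; apply: lt_le_trans Ssmall _.
    by rewrite le_eqVlt; apply/orP; left; apply/eqP; field; rewrite !gt_eqF.
  have h2 : k * e0 = c / 4 by rewrite /e0; field; rewrite gt_eqF.
  by rewrite mulrDr h2; lra.
have [Q [Qr QP]] := avoiding_path total0.
have [z Qz] := path_cvg r01 hf a Q.
have [n _ Cz] := FC z (ex_intro _ Q (conj Qr Qz)).
have [m [y [v [cE yW lt]]]] := QP (level n).
apply: (bad_excluded _ lt); rewrite mem_filter yW andbT.
apply/asboolP; exists z => //; rewrite -cE.
exact: limit_close.
Qed.

End content.

(** * Dimensions from covers and contents *)

Section dimensions.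
Variables (R : realType) (d : nat).
Implicit Types (A C : set 'rV[R]_d) (s t delta : R).

Lemma ediam_ge0 A : A !=set0 -> (0 <= ediam A)%E.
Proof. by move=> [x Ax]; have := le_ediam Ax Ax; rewrite subrr enorm0. Qed.

Lemma diam_weight_ge0 s A : (0 <= diam_weight s A)%E.
Proof. by rewrite /diam_weight; case: ifP => // _; exact: poweR_ge0. Qed.

Lemma diam_weight0 s : diam_weight s (set0 : set 'rV[R]_d) = 0%E.
Proof. by rewrite /diam_weight asboolT. Qed.

Lemma diam_weightE s A : A !=set0 -> diam_weight s A = poweR (ediam A) s.
Proof. by move=> /set0P/eqP A0; rewrite /diam_weight asboolF. Qed.

Lemma diam_weight_le s delta A : 0 <= s -> 0 <= delta ->
  (ediam A <= delta%:E)%E -> (diam_weight s A <= (delta `^ s)%:E)%E.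
Proof.
move=> s0 delta0 dA; have [->|/set0P A0] := eqVneq A set0.
  by rewrite diam_weight0 lee_fin powR_ge0.
rewrite diam_weightE// -poweR_EFin; apply: gt0_ler_poweR => //.
  by rewrite in_itv/= ediam_ge0// leey.
by rewrite in_itv/= lee_fin delta0 leey.
Qed.

Lemma diam_weight_exponent s t A : 0 <= t -> t <= s -> 0 < s -> (ediam A <= 1)%E ->
  (diam_weight s A <= diam_weight t A)%E.
Proof.
move=> t0 ts s0 A1; have [->|/set0P A0] := eqVneq A set0; first by rewrite !diam_weight0.
rewrite !diam_weightE//; have := ediam_ge0 A0; move: A1.
case: (ediam A) => [D||]//; rewrite !lee_fin => D1 D0.
move: D0; rewrite le_eqVlt => /predU1P[<-|D0].
  by rewrite powR0 ?gt_eqF// powR_ge0.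
have -> : D `^ s = D `^ t * D `^ (s - t).
  by rewrite -powRD; [rewrite addrC subrK | apply/implyP => _; rewrite gt_eqF].
rewrite -[leRHS]mulr1 ler_wpM2l ?powR_ge0//.
have -> : 1 = 1 `^ (s - t) :> R by rewrite powR1.
by apply: ge0_ler_powR; rewrite ?nnegrE ?subr_ge0// ltW.
Qed.

Definition pad n (C : 'I_n -> set 'rV[R]_d) (k : nat) : set 'rV[R]_d :=
  if insub k is Some i then C i else set0.

Lemma pad_cover n (C : 'I_n -> set 'rV[R]_d) : \bigcup_i C i `<=` \bigcup_k pad C k.
Proof. by move=> x [i _ Cx]; exists (val i) => //; rewrite /pad valK. Qed.

Lemma ediam_pad n (C : 'I_n -> set 'rV[R]_d) (e : \bar R) k :
  (forall i, (ediam (C i) <= e)%E) -> (ediam (pad C k) <= e)%E.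
Proof. by move=> Ce; rewrite /pad; case: insub => [i|]; rewrite ?ediam0 ?leNye. Qed.

Lemma sum_diam_weight_pad s delta n (C : 'I_n -> set 'rV[R]_d) :
  0 <= s -> 0 <= delta -> (forall i, (ediam (C i) <= delta%:E)%E) ->
  (\sum_(0 <= k <oo) diam_weight s (pad C k) <= (n%:R * delta `^ s)%:E)%E.
Proof.
move=> s0 delta0 Cd; rewrite (nneseries_split 0 n); last first.
  by move=> k _; exact: diam_weight_ge0.
rewrite [X in (_ + X)%E]eseries0 ?adde0; last first.
  move=> k nk _; rewrite /pad insubF ?diam_weight0//.
  by apply/negbTE; rewrite -leqNgt.
rewrite add0n; apply: (@le_trans _ _ (\sum_(0 <= k < n) (delta `^ s)%:E)%E).
  by apply: lee_sum => k _; apply: diam_weight_le => //; exact: ediam_pad.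
by rewrite sumEFin big_const_nat iter_addr_0 subn0 -[_ *+ n]mulr_natl.
Qed.

Lemma premeasure_ge0 s delta A : (0 <= hausdorff_premeasure s delta A)%E.
Proof.
apply: le_ereal_inf_tmp => _ [C [_ _ ->]]; apply: nneseries_ge0 => n _ _.
exact: diam_weight_ge0.
Qed.

Lemma hausdorff_dim_le s t A : covers_at_rate s A -> 0 <= t -> s < t ->
  (hausdorff_dim A <= t%:E)%E.
Proof.
move=> [B B0 cov] t0 st; apply: ereal_inf_lbound; exists t => //; split => //.
have pre0 delta : 0 < delta -> hausdorff_premeasure t delta A = 0%E.
  move=> delta0; apply/eqP; rewrite eq_le premeasure_ge0 andbT.
  apply/lee_addgt0Pr => e e0; rewrite add0e.
  have ts0 : 0 < t - s by rewrite subr_gt0.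
  have eB0 : 0 < e / B by rewrite divr_gt0.
  pose eta := Num.min (Num.min delta 2^-1) ((e / B) `^ (t - s)^-1).
  have eta0 : 0 < eta by rewrite /eta !lt_min delta0 invr_gt0 ltr0n powR_gt0.
  have etad : eta <= delta by rewrite /eta !ge_min lexx.
  have eta1 : eta < 1.
    apply: (@le_lt_trans _ _ 2^-1); first by rewrite /eta !ge_min lexx orbT.
    by rewrite invf_lt1// ltr1n.
  have etae : eta `^ (t - s) <= e / B.
    have -> : e / B = ((e / B) `^ (t - s)^-1) `^ (t - s).
      by rewrite -powRrM mulVf ?gt_eqF// powRr1// ltW.
    apply: ge0_ler_powR; rewrite ?nnegrE ?powR_ge0//; [exact: ltW | exact: ltW |].
    by rewrite /eta ge_min lexx orbT.
  have [|m [C [AC dC mB]]] := cov eta; first by rewrite eta0.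
  apply: (@le_trans _ _ (\sum_(0 <= k <oo) diam_weight t (pad C k))%E).
    apply: ereal_inf_lbound; exists (pad C); split => //.
      by apply: subset_trans AC _; exact: pad_cover.
    by move=> n; apply: ediam_pad => i; apply: le_trans (dC i) _; rewrite lee_fin.
  apply: le_trans (sum_diam_weight_pad t0 (ltW eta0) dC) _; rewrite lee_fin.
  apply: (@le_trans _ _ (B * eta `^ (- s) * eta `^ t)).
    by rewrite ler_wpM2r// powR_ge0.
  rewrite -mulrA -powRD; last by apply/implyP => _; rewrite gt_eqF.
  by rewrite addrC mulrC -ler_pdivlMr.
rewrite /hausdorff_measure.
suff -> : [set hausdorff_premeasure t delta A | delta in [set u | 0 < u]] = [set 0%E].
  by rewrite ereal_sup1.
apply/seteqP; split => [_ [delta /= delta0 <-]|_ ->] /=; first exact: pre0.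
by exists 1 => //=; apply: pre0.
Qed.

Lemma hausdorff_dim_ge s A : 0 < s -> content_positive s A ->
  (s%:E <= hausdorff_dim A)%E.
Proof.
move=> s0 [c c0 cA]; apply: le_ereal_inf_tmp => _ [t [t0 Ht] <-].
rewrite lee_fin leNgt; apply/negP => ts.
have : (hausdorff_premeasure t 1 A < c%:E)%E.
  apply: (@le_lt_trans _ _ 0%E); last by rewrite lte_fin.
  by rewrite -Ht; apply: ereal_sup_ubound; exists 1 => //=.
move=> /ereal_inf_lt[_ [C [AC C1 ->]]]; apply/negP; rewrite -leNgt.
apply: le_trans (cA C AC C1) _; apply: lee_nneseries => n _.
  by move=> _; exact: diam_weight_ge0.
by apply: diam_weight_exponent; rewrite // ltW.
Qed.

Lemma covering_number_le s A : covers_at_rate s A -> exists2 B : R, 0 < B &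
  forall delta, 0 < delta < 1 ->
    (covering_number delta A <= (B * delta `^ (- s))%:E)%E.
Proof.
move=> [B B0 cov]; exists B => // delta d01; have [m [C [AC dC mB]]] := cov _ d01.
apply: (@le_trans _ _ (m%:R%:E)); last by rewrite lee_fin.
by apply: ereal_inf_lbound; exists m, C.
Qed.

Lemma covering_number_ge s A : 0 <= s -> content_positive s A -> exists2 c : R, 0 < c &
  forall delta, 0 < delta < 1 ->
    ((c * delta `^ (- s))%:E <= covering_number delta A)%E.
Proof.
move=> s0 [c c0 cA]; exists c => // delta /andP[delta0 delta1].
apply: le_ereal_inf_tmp => _ [n [C [AC dC ->]]]; rewrite lee_fin.
rewrite powRN ler_pdivrMr ?powR_gt0// -lee_fin.
apply: le_trans (sum_diam_weight_pad s0 (ltW delta0) dC).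
apply: cA; first by apply: subset_trans AC _; exact: pad_cover.
by move=> k; apply: ediam_pad => i; apply: le_trans (dC i) _; rewrite lee_fin ltW.
Qed.

Let ln_rate (c s delta : R) : 0 < c -> 0 < delta < 1 ->
  ln (c * delta `^ (- s)) * (- ln delta)^-1 = s + ln c / (- ln delta).
Proof.
move=> c0 /andP[d0 d1]; rewrite lnM ?posrE ?powR_gt0// ln_powR.
have l0 : ln delta < 0 by rewrite ln_lt0// d0.
by field; rewrite lt_eqF.
Qed.

Let ln_small (c e : R) : 0 < e ->
  \forall delta \near (0 : R)^'+, 0 < delta < 1 /\ `|ln c / (- ln delta)| <= e.
Proof.
move=> e0; near=> delta.
have d0 : 0 < delta by near: delta; exact: nbhs_right_gt.
have d1 : delta < 1 by near: delta; exact: nbhs_right_lt.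
have l0 : 0 < - ln delta by rewrite oppr_gt0 ln_lt0// d0.
split; first by rewrite d0.
rewrite normrM normfV (gtr0_norm l0) ler_pdivrMr// mulrC -ler_pdivrMr//.
have de : delta < expR (- (`|ln c| / e)).
  by near: delta; apply: nbhs_right_lt; exact: expR_gt0.
by rewrite lerNr -ler_expR lnK ?posrE// ltW.
Unshelve. all: by end_near.
Qed.

Lemma box_ratio_le s A e : covers_at_rate s A -> 0 < e ->
  \forall delta \near (0 : R)^'+, (box_ratio A delta <= (s + e)%:E)%E.
Proof.
move=> /covering_number_le[B B0 covB] e0.
near=> delta.
have [d01 le] : 0 < delta < 1 /\ `|ln B / (- ln delta)| <= e.
  by near: delta; exact: ln_small.
have l0 : 0 < - ln delta by rewrite oppr_gt0 ln_lt0.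
have B'0 : 0 < B * delta `^ (- s) by rewrite mulr_gt0// powR_gt0//; case/andP: d01.
apply: (@le_trans _ _ ((ln (B * delta `^ (- s)))%:E * ((- ln delta)^-1)%:E)%E).
  rewrite /box_ratio lee_wpmul2r ?lee_fin ?invr_ge0 ?(ltW l0)//.
  have := covB _ d01; case: (covering_number delta A) => [x||]//=; last by move=> _; rewrite leNye.
  rewrite lee_fin => xB; case: ifPn => [_|]; first by rewrite leNye.
  by rewrite -ltNge => x0; rewrite lee_fin ler_ln ?posrE //.
rewrite -EFinM lee_fin ln_rate// lerD2l; apply: le_trans le; exact: ler_norm.
Unshelve. all: by end_near.
Qed.

Lemma box_ratio_ge s A e : 0 <= s -> content_positive s A -> 0 < e ->
  \forall delta \near (0 : R)^'+, ((s - e)%:E <= box_ratio A delta)%E.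
Proof.
move=> s0 cA e0; have [c c0 covc] := covering_number_ge s0 cA.
near=> delta.
have [d01 le] : 0 < delta < 1 /\ `|ln c / (- ln delta)| <= e.
  by near: delta; exact: ln_small.
have l0 : 0 < - ln delta by rewrite oppr_gt0 ln_lt0.
have c'0 : 0 < c * delta `^ (- s) by rewrite mulr_gt0// powR_gt0//; case/andP: d01.
apply: (@le_trans _ _ ((ln (c * delta `^ (- s)))%:E * ((- ln delta)^-1)%:E)%E).
  rewrite -EFinM lee_fin ln_rate// lerD2l.
  by rewrite lerNl; apply: le_trans le; rewrite -normrN ler_norm.
rewrite /box_ratio lee_wpmul2r ?lee_fin ?invr_ge0 ?(ltW l0)//.
have := covc _ d01; case: (covering_number delta A) => [x||]//=; last by move=> _; rewrite leey.
rewrite lee_fin => cx; have x0 := lt_le_trans c'0 cx.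
case: ifPn => [|_]; first by rewrite leNgt x0.
by rewrite lee_fin ler_ln ?posrE.
Unshelve. all: by end_near.
Qed.

Let lower_le (g : R -> \bar R) (z : \bar R) :
  (\forall delta \near (0 : R)^'+, (g delta <= z)%E) ->
  (limf_einf g (0 : R)^'+ <= z)%E /\ (limf_esup g (0 : R)^'+ <= z)%E.
Proof.
move=> gz; split; last first.
  rewrite limf_esupE.
  apply: (@le_trans _ _ (ereal_sup [set g x | x in [set x | (g x <= z)%E]])).
    by apply: ereal_inf_lbound; exists [set x | (g x <= z)%E].
  by apply: ge_ereal_sup => _ [x /= gxz <-].
rewrite limf_einfE; apply: ge_ereal_sup => _ [V FV <-].
have [x [Vx gx]] := filter_ex (filterI FV gz).
by apply: le_trans gx; apply: ereal_inf_lbound; exists x.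
Qed.

Let upper_ge (g : R -> \bar R) (z : \bar R) :
  (\forall delta \near (0 : R)^'+, (z <= g delta)%E) ->
  (z <= limf_einf g (0 : R)^'+)%E /\ (z <= limf_esup g (0 : R)^'+)%E.
Proof.
move=> gz; split.
  rewrite limf_einfE.
  apply: (@le_trans _ _ (ereal_inf [set g x | x in [set x | (z <= g x)%E]])).
    by apply: le_ereal_inf_tmp => _ [x /= gxz <-].
  by apply: ereal_sup_ubound; exists [set x | (z <= g x)%E].
rewrite limf_esupE; apply: le_ereal_inf_tmp => _ [V FV <-].
have [x [Vx gx]] := filter_ex (filterI FV gz).
by apply: le_trans gx _; apply: ereal_sup_ubound; exists x.
Qed.

(** Covers with exponents decreasing to v and contents with exponents increasing
    to v determine all dimensions at once. *)
Lemma dimensions_eq (v : R) A : 0 < v ->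
  (forall n, covers_at_rate (v + n.+1%:R^-1) A) ->
  (forall n, content_positive (v - v / n.+2%:R) A) ->
  hausdorff_dim A = v%:E /\ has_box_dim A v%:E.
Proof.
move=> v0 up lo.
have smallr (e : R) : 0 < e -> exists n, n.+1%:R^-1 < e.
  move=> e0; have [n [n0 ne]] := natr_gt_bound e^-1.
  exists n; rewrite invf_plt ?posrE//; apply: lt_trans ne _; by rewrite ltr_nat.
have up' e : 0 < e -> exists2 s, s < v + e & 0 < s /\ covers_at_rate s A.
  move=> e0; have [n ne] := smallr e e0; exists (v + n.+1%:R^-1); first by rewrite ltrD2l.
  by split => //; rewrite addr_gt0// invr_gt0.
have lo' e : 0 < e -> exists2 s, v - e < s & 0 < s /\ content_positive s A.
  move=> e0; have [n ne] := smallr (e / v) (divr_gt0 e0 v0).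
  exists (v - v / n.+2%:R).
    rewrite ltrD2l ltrN2 mulrC -ltr_pdivlMr//; apply: lt_trans ne.
    by rewrite ltf_pV2 ?posrE// ltr_nat.
  split => //; rewrite subr_gt0 ltr_pdivrMr// ltr_pMr// ltr1n//.
have le_v (z : \bar R) : (forall s e, 0 < s -> 0 < e -> covers_at_rate s A ->
    (z <= (s + e)%:E)%E) -> (z <= v%:E)%E.
  move=> h; apply/lee_addgt0Pr => e e0.
  have e20 : 0 < e / 2 by rewrite divr_gt0.
  have [s sv [s0 As]] := up' _ e20.
  by apply: le_trans (h s _ s0 e20 As) _; rewrite -EFinD lee_fin; lra.
have ge_v (z : \bar R) : (forall s e, 0 < s -> 0 < e -> content_positive s A ->
    ((s - e)%:E <= z)%E) -> (v%:E <= z)%E.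
  move=> h; apply/lee_subgt0Pr => e e0.
  have e20 : 0 < e / 2 by rewrite divr_gt0.
  have [s sv [s0 As]] := lo' _ e20.
  by apply: le_trans (h s _ s0 e20 As); rewrite -EFinB lee_fin; lra.
split.
  apply/eqP; rewrite eq_le; apply/andP; split.
    apply: le_v => s e s0 e0 As; apply: (hausdorff_dim_le As); last by rewrite ltrDl.
    by rewrite addr_ge0 ?ltW.
  apply: ge_v => s e s0 e0 As; apply: le_trans (hausdorff_dim_ge s0 As).
  by rewrite lee_fin gerBl ltW.
split; apply/eqP; rewrite eq_le; apply/andP; split.
- by apply: le_v => s e s0 e0 As; have [] := lower_le (box_ratio_le As e0).
- by apply: ge_v => s e s0 e0 As; have [] := upper_ge (box_ratio_ge (ltW s0) As e0).
- by apply: le_v => s e s0 e0 As; have [] := lower_le (box_ratio_le As e0).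
- by apply: ge_v => s e s0 e0 As; have [] := upper_ge (box_ratio_ge (ltW s0) As e0).
Qed.

End dimensions.

Theorem theorem2p1 (R : realType) (N d M : nat)
  (hN : (2 <= N)%N) (hd : (1 <= d)%N) (hM : (2 <= M)%N)
  (f : 'I_N -> 'rV[R]_d -> 'rV[R]_d) (r : 'I_N -> R)
  (hr : forall i, 0 < r i < 1)
  (hf : forall i, similarity (r i) (f i))
  (hU : exists U : set 'rV[R]_d,
     [/\ U !=set0, bounded_set U, open U & open_set_condition f U])
  (p : 'I_N -> R) (hp : forall i, 0 < p i < 1) (hp1 : \sum_(i < N) p i = 1)
  (disp : measure_display) (T : measurableType disp) (P : probability T R)
  (omega : edge M -> T -> 'I_N) (homega : random_labelling P p omega) :
  exists v : R,
    is_maximum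
      [set psi x + Num.min 0 (phi M p x) | x in
         [set x : 'I_N -> R | (forall i, 0 <= x i) /\ hfun r x = 1]] v /\
    {ae P, forall t,
       let F := limit_set f (fun e => omega e t) in
       hausdorff_dim F = v%:E /\ has_box_dim F v%:E}.
Proof.
pose i0 : 'I_N := Ordinal (leq_trans (ltnSn 0) (ltnW hN)).
have p0 i : 0 < p i by have /andP[] := hp i.
have M0 : (0 < M)%N by exact: leq_trans hM.
have [x [x0 hx xmax]] := exists_max_rate M hN hr hp.
pose v := rate M p x.
have v0 : 0 < v by exact: (max_rate_gt0 hN hM hr hp hp1 xmax).
exists v; split.
  split; first by exists x.
  by move=> _ [y [y0 hy] <-]; exact: xmax.
have [U [U0 _ oU oscU]] := hU.
have up n : {ae P, forall t,
    covers_at_rate (v + n.+1%:R^-1) (limit_set f (fun e => omega e t))}.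
  have n0 : 0 < n.+1%:R^-1 :> R by rewrite invr_gt0.
  have vn : v < v + n.+1%:R^-1 by rewrite ltrDl.
  apply: filterS (mass_bounded i0 hM p0 hp1 hr xmax homega vn) => t [B massB].
  by apply: (covering_bound hr hf _ massB); rewrite ltW// (lt_trans v0).
have lo n : {ae P, forall t,
    content_positive (v - v / n.+2%:R) (limit_set f (fun e => omega e t))}.
  set s := v - v / n.+2%:R.
  have s0 : 0 < s by rewrite subr_gt0 ltr_pdivrMr// ltr_pMr// ltr1n.
  have sv : s < v by rewrite gtrBl divr_gt0.
  have [K [W [rho [[K0 rho01] uW sW rW rich]]]] := rich_family M0 hr p0 x0 hx sv.
  have lam1 : 1 <= rho `^ (- s).
    have /andP[rho0 rho1] := rho01.
    rewrite powRN invf_ge1 ?powR_gt0//.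
    have -> : 1 = 1 `^ s :> R by rewrite powR1.
    by apply: ge0_ler_powR; rewrite ?nnegrE ?ler01 ?ltW.
  apply: (filterS _ (flow_survives i0 hM p0 hp1 homega uW sW lam1 rich)) => t [u uP].
  apply: (content_lower hr hf U0 oU oscU K0 uW sW rho01 rW s0 _ uP).
  by rewrite divr_gt0// (flow_bound_gt0 lam1 M0 p0 rich).
apply: filterS2 (ae_foralln up) (ae_foralln lo) => t upt lot.
exact: dimensions_eq.
Qed.
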